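(* Let $(B,\beta)$ and $(H,\alpha)$ be two monoidal Hom-Hopf algebras over a field $k$. Suppose that $(B,\beta)$ is a left $(H,\alpha)$-Hom-module algebra with action $h\otimes b\mapsto h\cdot b$, and that $(H,\alpha)$ is a right $(B,\beta)$-Hom-comodule coalgebra with coaction $\rho:H\to H\otimes B$, $\rho(h)=\sum h_{(0)}\otimes h_{(1)}$. Equip $B\#H=B\otimes H$ (write $a\#h$ for $a\otimes h$), with twisting automorphism $\beta\#\alpha=\beta\otimes\alpha$, with the Hom-smash product $$(a\#h)(b\#k)=\sum a(h_{1}\cdot\beta^{-1}(b))\#\alpha(h_{2})k,\qquad \text{unit } 1_B\#1_H,$$ and the Hom-smash coproduct $$\Delta(a\#h)=\sum a_{1}\#\alpha(h_{1(0)})\otimes\beta^{-1}(a_{2})h_{1(1)}\# h_{2},\qquad \varepsilon(a\#h)=\varepsilon_{B}(a)\varepsilon_{H}(h).$$ Then $(B\#H,\beta\#\alpha)$ is a monoidal Hom-bialgebra if and only if the following hold for all $h,k\in H$ and $b\in B$: 1. $\Delta(h\cdot b)=\sum\alpha(h_{1(0)})\cdot b_{1}\otimes\beta(h_{1(1)})(\alpha^{-1}(h_{2})\cdot\beta^{-1}(b_{2}))$; 2. $\varepsilon_{B}(h\cdot b)=\varepsilon_{H}(h)\varepsilon_{B}(b)$; 3. $\rho(1_{H})=1_{H}\otimes 1_{B}$; 4. $\sum h_{2(0)}\otimes(h_{1}\cdot b)\beta^{2}(h_{2(1)})=\sum h_{1(0)}\otimes\beta^{2}(h_{1(1)})(h_{2}\cdot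 b)$; 5. $\sum(hk)_{(0)}\otimes(hk)_{(1)}=\sum\alpha(h_{1(0)})k_{(0)}\otimes\beta(h_{1(1)})(\alpha^{-1}(h_{2})\cdot\beta^{-1}(k_{(1)}))$.
   Context: All vector spaces, tensor products and linear maps are over a fixed field $k$; Sweedler notation $\Delta(c)=\sum c_1\otimes c_2$ is used, with iterated indices such as $h_{1(0)}$ meaning $(h_1)_{(0)}$. Monoidal Hom-algebra $(A,\alpha)$: a vector space $A$ with a linear automorphism $\alpha$, a linear multiplication $a\otimes b\mapsto ab$ and an element $1_A$ with $\alpha(a)(bc)=(ab)\alpha(c)$, $a1_A=\alpha(a)=1_Aa$, $\alpha(ab)=\alpha(a)\alpha(b)$, $\alpha(1_A)=1_A$. Monoidal Hom-coalgebra $(C,\gamma)$: a vector space $C$ with a linear automorphism $\gamma$ and linear maps $\Delta:C\to C\otimes C$, $\varepsilon:C\to k$ with $\sum\gamma^{-1}(c_1)\otimes\Delta(c_2)=\sum\Delta(c_1)\otimes\gamma^{-1}(c_2)$, $\sum c_1\varepsilon(c_2)=\sum\varepsilon(c_1)c_2=\gamma^{-1}(c)$, $\Delta(\gamma(c))=\sum\gamma(c_1)\otimes\gamma(c_2)$, $\varepsilon(\gamma(c))=\varepsilon(c)$. Monoidal Hom-bialgebra: $(H,\alpha)$ which is both a monoidal Hom-algebra and a monoidal Hom-coalgebra (same $\alpha$), with $\Delta(gh)=\Delta(g)\Delta(h)$, $\Delta(1)=1\otimes1$, $\varepsilon(gh)=\varepsilon(g)\varepsilon(h)$, $\varepsilon(1)=1$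 (componentwise product on $H\otimes H$). Monoidal Hom-Hopf algebra: a monoidal Hom-bialgebra with a linear map $S:H\to H$ such that $S\alpha=\alpha S$ and $\sum S(h_1)h_2=\varepsilon(h)1=\sum h_1S(h_2)$. Left $(H,\alpha)$-Hom-module $(M,\mu)$: $\mu$ a linear automorphism of $M$ and a linear map $H\otimes M\to M$ with $\alpha(h)\cdot(g\cdot m)=(hg)\cdot\mu(m)$, $1\cdot m=\mu(m)$, $\mu(h\cdot m)=\alpha(h)\cdot\mu(m)$. A left $(H,\alpha)$-Hom-module algebra is a monoidal Hom-algebra $(B,\beta)$ that is a left Hom-module (with automorphism $\beta$) with $h\cdot(ab)=\sum(h_1\cdot a)(h_2\cdot b)$, $h\cdot1_B=\varepsilon(h)1_B$. Right $(C,\gamma)$-Hom-comodule $(M,\mu)$: $\mu$ a linear automorphism of $M$ and a linear map $\rho:M\to M\otimes C$, $\rho(m)=\sum m_{(0)}\otimes m_{(1)}$, with $\sum\mu^{-1}(m_{(0)})\otimes\Delta(m_{(1)})=\sum\rho(m_{(0)})\otimes\gamma^{-1}(m_{(1)})$, $\sum\varepsilon(m_{(1)})m_{(0)}=\mu^{-1}(m)$, $\rho(\mu(m))=\sum\mu(m_{(0)})\otimes\gamma(m_{(1)})$. For a monoidal Hom-bialgebra $(B,\beta)$, a right $(B,\beta)$-Hom-comodule coalgebra is a monoidal Hom-coalgebra $(C,\gamma)$ that is a right $(B,\beta)$-Hom-comodule (with automorphism $\gamma$) with $\sum c_{(0)1}\otimes c_{(0)2}\otimes c_{(1)}=\sum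 c_{1(0)}\otimes c_{2(0)}\otimes c_{1(1)}c_{2(1)}$ and $\sum\varepsilon(c_{(0)})c_{(1)}=\varepsilon(c)1_B$. *)

(* Defs.v *)
From HB Require Import structures.
From mathcomp Require Import all_boot all_order all_algebra.
From mathcomp Require Import generic_quotient boolp.

Set Implicit Arguments.
Unset Strict Implicit.
Unset Printing Implicit Defensive.

Import GRing.Theory.
Local Open Scope ring_scope.
Local Open Scope quotient_scope.

(* MathComp has no tensor product of arbitrary (possibly infinite-dimensional)
   vector spaces. We construct U ⊗ V as the quotient of the formal finite sums
   of pairs (u, v) by the congruence generated by the bilinearity relations,
   i.e. two formal sums are identified when every bilinear map sends them to
   the same vector. The universal property is established below: tens_bilinear,
   tlift_tens, tlift_linear and tens_ext. *)
Section TensorProduct.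
Variables (k : fieldType) (U V : lmodType k).

Definition bilinear_map (W : lmodType k) (f : U -> V -> W) : Prop :=
  bilinear_for *:%R *:%R f.

Definition formal_eval (W : lmodType k) (f : U -> V -> W) (s : seq (U * V)) : W :=
  \sum_(p <- s) f p.1 p.2.

Definition tens_rel (s t : seq (U * V)) : bool :=
  `[< forall (W : lmodType k) (f : U -> V -> W),
      bilinear_map f -> formal_eval f s = formal_eval f t >].

Lemma tens_rel_equiv : equiv_class_of tens_rel.
Proof.
split.
- by move=> s; apply/asboolP.
- by move=> s t; apply/asboolP/asboolP => e W f hf; rewrite e.
- move=> s t u /asboolP h1 /asboolP h2; apply/asboolP => W f hf.
  by rewrite h1 ?h2.
Qed.

Canonical tens_equiv := EquivRelPack tens_rel_equiv.

Definition tensor : Type := {eq_quot tens_equiv}.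
HB.instance Definition _ := Choice.on tensor.
HB.instance Definition _ := EqQuotient.on tensor.

Definition tlift (W : lmodType k) (f : U -> V -> W) (t : tensor) : W :=
  formal_eval f (repr t).

Definition tens (u : U) (v : V) : tensor := \pi_tensor [:: (u, v)].

Lemma tlift_pi (W : lmodType k) (f : U -> V -> W) (s : seq (U * V)) :
  bilinear_map f -> tlift f (\pi_tensor s) = formal_eval f s.
Proof.
move=> hf; have: \pi_tensor (repr (\pi_tensor s)) = \pi_tensor s by rewrite reprK.
by move/eqmodP/asboolP => /(_ W f hf).
Qed.

Lemma tensor_eqP (x y : tensor) :
  (forall (W : lmodType k) (f : U -> V -> W),
     bilinear_map f -> tlift f x = tlift f y) <-> x = y.
Proof.
split=> [h|->//]; rewrite -[x]reprK -[y]reprK; apply/eqmodP/asboolP.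
exact: h.
Qed.

Definition tens_zero : tensor := \pi_tensor [::].
Definition tens_add (x y : tensor) : tensor := \pi_tensor (repr x ++ repr y).
Definition tens_scale (a : k) (x : tensor) : tensor :=
  \pi_tensor [seq (a *: p.1, p.2) | p <- repr x].
Definition tens_opp : tensor -> tensor := tens_scale (-1).

Lemma bilinear_mapDl (W : lmodType k) (f : U -> V -> W) : bilinear_map f ->
  forall u u' v, f (u + u') v = f u v + f u' v.
Proof.
by move=> hf u u' v; have := hf.1 v 1 u u'; rewrite /= !scale1r.
Qed.

Lemma bilinear_mapZl (W : lmodType k) (f : U -> V -> W) : bilinear_map f ->
  forall a u v, f (a *: u) v = a *: f u v.
Proof.
move=> hf a u v.
have f0 : f 0 v = 0.
  apply: (addrI (f 0 v)); rewrite -bilinear_mapDl // !addr0 //.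
by have := hf.1 v a u 0; rewrite /= !addr0 f0 addr0.
Qed.

Lemma bilinear_mapDr (W : lmodType k) (f : U -> V -> W) : bilinear_map f ->
  forall u v v', f u (v + v') = f u v + f u v'.
Proof.
by move=> hf u v v'; have := hf.2 u 1 v v'; rewrite /= !scale1r.
Qed.

Lemma bilinear_mapZr (W : lmodType k) (f : U -> V -> W) : bilinear_map f ->
  forall a u v, f u (a *: v) = a *: f u v.
Proof.
move=> hf a u v.
have f0 : f u 0 = 0.
  apply: (addrI (f u 0)); rewrite -bilinear_mapDr // !addr0 //.
by have := hf.2 u a v 0; rewrite /= !addr0 f0 addr0.
Qed.

Lemma bilinear_mapI (W : lmodType k) (f : U -> V -> W) :
  (forall v, linear (f^~ v)) -> (forall u, linear (f u)) -> bilinear_map f.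
Proof. by []. Qed.

Section LiftOps.
Variables (W : lmodType k) (f : U -> V -> W).
Hypothesis hf : bilinear_map f.

Lemma tlift_zero : tlift f tens_zero = 0.
Proof. by rewrite tlift_pi // /formal_eval big_nil. Qed.

Lemma tlift_add x y : tlift f (tens_add x y) = tlift f x + tlift f y.
Proof. by rewrite tlift_pi // /formal_eval big_cat. Qed.

Lemma tlift_scale a x : tlift f (tens_scale a x) = a *: tlift f x.
Proof.
rewrite tlift_pi // /formal_eval big_map scaler_sumr; apply: eq_bigr => p _ /=.
exact: bilinear_mapZl.
Qed.

Lemma tlift_tens u v : tlift f (tens u v) = f u v.
Proof. by rewrite tlift_pi // /formal_eval big_seq1. Qed.

End LiftOps.

Fact tens_addA : associative tens_add.
Proof.
move=> x y z; apply/tensor_eqP => W f hf.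
by rewrite !tlift_add // addrA.
Qed.

Fact tens_addC : commutative tens_add.
Proof.
move=> x y; apply/tensor_eqP => W f hf.
by rewrite !tlift_add // addrC.
Qed.

Fact tens_add0 : left_id tens_zero tens_add.
Proof.
move=> x; apply/tensor_eqP => W f hf.
by rewrite tlift_add // tlift_zero // add0r.
Qed.

Fact tens_addN : left_inverse tens_zero tens_opp tens_add.
Proof.
move=> x; apply/tensor_eqP => W f hf.
by rewrite tlift_add // tlift_scale // tlift_zero // scaleN1r addNr.
Qed.

HB.instance Definition _ :=
  GRing.isZmodule.Build tensor tens_addA tens_addC tens_add0 tens_addN.

Fact tens_scaleA a b x : tens_scale a (tens_scale b x) = tens_scale (a * b) x.
Proof. by apply/tensor_eqP => W f hf; rewrite !tlift_scale // scalerA. Qed.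

Fact tens_scale1 : left_id 1 tens_scale.
Proof. by move=> x; apply/tensor_eqP => W f hf; rewrite tlift_scale // scale1r. Qed.

Fact tens_scaleDr : right_distributive tens_scale +%R.
Proof.
move=> a x y; apply/tensor_eqP => W f hf.
by rewrite tlift_scale // !tlift_add // !tlift_scale // scalerDr.
Qed.

Fact tens_scaleDl x : {morph tens_scale^~ x : a b / a + b}.
Proof.
move=> a b; apply/tensor_eqP => W f hf.
by rewrite tlift_add // !tlift_scale // scalerDl.
Qed.

HB.instance Definition _ := GRing.Zmodule_isLmodule.Build k tensor
  tens_scaleA tens_scale1 tens_scaleDr tens_scaleDl.

Lemma tlift_linear (W : lmodType k) (f : U -> V -> W) :
  bilinear_map f -> linear (tlift f).
Proof.
by move=> hf a x y; rewrite (tlift_add hf) (tlift_scale hf).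
Qed.

End TensorProduct.

Lemma tens_bilinear (k : fieldType) (U V : lmodType k) :
  bilinear_map (@tens k U V).
Proof.
apply: bilinear_mapI => [v a u u'|u a v v'];
  apply/tensor_eqP => W f hf; rewrite (tlift_linear hf) !tlift_tens //.
  by rewrite bilinear_mapDl // bilinear_mapZl.
by rewrite bilinear_mapDr // bilinear_mapZr.
Qed.

Arguments tensor {k} U%_type V%_type.

Notation "U ⊗ V" := (tensor U V)
  (at level 41, right associativity) : type_scope.
Notation "u ⊗ v" := (tens u v)
  (at level 41, right associativity) : ring_scope.

(* Sweedler sums: \sw_(x ⊗ y <- t) E is the sum of E over the pairs (x, y) of a
   representative \sum x ⊗ y of the tensor t; when E is bilinear in x and y, it
   is the image of t under the linear map induced by E. *)
Notation "\sw_ ( x ⊗ y <- t ) E" := (tlift (fun x y => E) t)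
  (at level 41, x name, y name, t at level 100, E at level 41,
   right associativity,
   format "'[' \sw_ ( x  ⊗  y  <-  t )  '/  '  E ']'") : ring_scope.

Lemma tens_reprE (k : fieldType) (U V : lmodType k) (t : U ⊗ V) :
  t = \sum_(p <- repr t) p.1 ⊗ p.2.
Proof.
apply/tensor_eqP => W f hf; rewrite {1}/tlift /formal_eval.
have h := tlift_linear hf.
elim: (repr t) => [|p s IHs]; first by rewrite !big_nil (tlift_zero hf).
by rewrite !big_cons IHs (tlift_add hf) tlift_tens.
Qed.

Lemma tens_ext (k : fieldType) (U V W : lmodType k) (f g : U ⊗ V -> W) :
  linear f -> linear g -> (forall u v, f (u ⊗ v) = g (u ⊗ v)) -> f =1 g.
Proof.
move=> hf hg fg t.
pose F : {linear (U ⊗ V)%type -> W} := HB.pack f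
  (GRing.isLinear.Build _ _ _ _ f hf).
pose G : {linear (U ⊗ V)%type -> W} := HB.pack g
  (GRing.isLinear.Build _ _ _ _ g hg).
rewrite -[f t]/(F t) -[g t]/(G t) [t]tens_reprE !linear_sum.
by apply: eq_bigr => p _; apply: fg.
Qed.

Record lin_aut (k : fieldType) (V : lmodType k) := LinAut {
  aut_fun :> V -> V;
  aut_inv : V -> V;
  aut_linear : linear aut_fun;
  aut_funK : cancel aut_fun aut_inv;
  aut_invK : cancel aut_inv aut_fun }.
Arguments lin_aut {k} V%_type.

Lemma aut_inv_linear (k : fieldType) (V : lmodType k) (f : lin_aut V) :
  linear (aut_inv f).
Proof.
move=> a u v; apply: (can_inj (aut_funK f)).
by rewrite aut_linear !aut_invK.
Qed.

Definition tmap (k : fieldType) (U V U' V' : lmodType k)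
    (f : U -> U') (g : V -> V') (t : U ⊗ V) : U' ⊗ V' :=
  \sw_(u ⊗ v <- t) f u ⊗ g v.

Section TensorMap.
Variables (k : fieldType) (U V U' V' : lmodType k).
Variables (f : U -> U') (g : V -> V').
Hypotheses (hf : linear f) (hg : linear g).

Lemma tmap_bilinear : bilinear_map (fun u v => f u ⊗ g v).
Proof.
have [h1 h2] := tens_bilinear U' V'.
apply: bilinear_mapI => [v a u u'|u a v v'].
  by rewrite hf; exact: h1.
by rewrite hg; exact: h2.
Qed.

Lemma tmap_linear : linear (tmap f g).
Proof. exact: tlift_linear tmap_bilinear. Qed.

Lemma tmap_tens u v : tmap f g (u ⊗ v) = f u ⊗ g v.
Proof. exact: (tlift_tens tmap_bilinear). Qed.

End TensorMap.

Section TensorAut.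
Variables (k : fieldType) (U V : lmodType k) (f : lin_aut U) (g : lin_aut V).

Lemma tens_autK : cancel (tmap f g) (tmap (aut_inv f) (aut_inv g)).
Proof.
have lF := tmap_linear (@aut_linear _ _ f) (@aut_linear _ _ g).
have lG := tmap_linear (aut_inv_linear f) (aut_inv_linear g).
apply: (@tens_ext _ _ _ _ _ id) => [a x y|a x y|u v] //.
  by rewrite lF lG.
by rewrite (tmap_tens (@aut_linear _ _ f) (@aut_linear _ _ g))
  (tmap_tens (aut_inv_linear f) (aut_inv_linear g)) !aut_funK.
Qed.

Lemma tens_aut_invK : cancel (tmap (aut_inv f) (aut_inv g)) (tmap f g).
Proof.
have lF := tmap_linear (@aut_linear _ _ f) (@aut_linear _ _ g).
have lG := tmap_linear (aut_inv_linear f) (aut_inv_linear g).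
apply: (@tens_ext _ _ _ _ _ id) => [a x y|a x y|u v] //.
  by rewrite lG lF.
by rewrite (tmap_tens (aut_inv_linear f) (aut_inv_linear g))
  (tmap_tens (@aut_linear _ _ f) (@aut_linear _ _ g)) !aut_invK.
Qed.

Definition tens_aut : lin_aut (U ⊗ V) :=
  LinAut (tmap_linear (@aut_linear _ _ f) (@aut_linear _ _ g))
    tens_autK tens_aut_invK.

End TensorAut.

Section HomStructures.
Variable k : fieldType.

(* Linear maps A ⊗ A -> A are given in curried form, as bilinear maps; equalities
   in a triple tensor product are stated in C ⊗ (C ⊗ C). *)
Record is_hom_algebra (A : lmodType k) (alpha : lin_aut A)
    (mul : A -> A -> A) (one : A) : Prop := {
  hom_mul_bilinear : bilinear_map mul;
  hom_mulA : forall a b c, mul (alpha a) (mul b c) = mul (mul a b) (alpha c);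
  hom_mulr1 : forall a, mul a one = alpha a;
  hom_mul1r : forall a, mul one a = alpha a;
  hom_autM : forall a b, alpha (mul a b) = mul (alpha a) (alpha b);
  hom_aut1 : alpha one = one }.

Record is_hom_coalgebra (C : lmodType k) (gamma : lin_aut C)
    (Delta : C -> C ⊗ C) (eps : C -> k) : Prop := {
  hom_comul_linear : linear Delta;
  hom_counit_linear : scalar eps;
  hom_coassoc : forall c,
    \sw_(c1 ⊗ c2 <- Delta c) \sw_(c21 ⊗ c22 <- Delta c2)
      aut_inv gamma c1 ⊗ (c21 ⊗ c22)
    = \sw_(c1 ⊗ c2 <- Delta c) \sw_(c11 ⊗ c12 <- Delta c1)
      c11 ⊗ (c12 ⊗ aut_inv gamma c2);
  hom_counitr : forall c,
    \sw_(c1 ⊗ c2 <- Delta c) eps c2 *: c1 = aut_inv gamma c;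
  hom_counitl : forall c,
    \sw_(c1 ⊗ c2 <- Delta c) eps c1 *: c2 = aut_inv gamma c;
  hom_comul_aut : forall c,
    Delta (gamma c) = \sw_(c1 ⊗ c2 <- Delta c) gamma c1 ⊗ gamma c2;
  hom_counit_aut : forall c, eps (gamma c) = eps c }.

Definition tens_mul (A B : lmodType k) (mA : A -> A -> A) (mB : B -> B -> B)
    (x y : A ⊗ B) : A ⊗ B :=
  \sw_(a ⊗ b <- x) \sw_(a' ⊗ b' <- y) mA a a' ⊗ mB b b'.

Record is_hom_bialgebra (H : lmodType k) (alpha : lin_aut H)
    (mul : H -> H -> H) (one : H) (Delta : H -> H ⊗ H) (eps : H -> k) : Prop := {
  hom_bialg_alg : is_hom_algebra alpha mul one;
  hom_bialg_coalg : is_hom_coalgebra alpha Delta eps;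
  hom_comulM : forall g h,
    Delta (mul g h) = tens_mul mul mul (Delta g) (Delta h);
  hom_comul1 : Delta one = one ⊗ one;
  hom_counitM : forall g h, eps (mul g h) = eps g * eps h;
  hom_counit1 : eps one = 1 }.

Record is_hom_hopf (H : lmodType k) (alpha : lin_aut H)
    (mul : H -> H -> H) (one : H) (Delta : H -> H ⊗ H) (eps : H -> k)
    (S : H -> H) : Prop := {
  hom_hopf_bialg : is_hom_bialgebra alpha mul one Delta eps;
  hom_antipode_linear : linear S;
  hom_antipode_aut : forall h, S (alpha h) = alpha (S h);
  hom_antipodel : forall h,
    \sw_(h1 ⊗ h2 <- Delta h) mul (S h1) h2 = eps h *: one;
  hom_antipoder : forall h,
    \sw_(h1 ⊗ h2 <- Delta h) mul h1 (S h2) = eps h *: one }.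

Record is_hom_module (H : lmodType k) (alpha : lin_aut H)
    (mul : H -> H -> H) (one : H)
    (M : lmodType k) (mu : lin_aut M) (act : H -> M -> M) : Prop := {
  hom_act_bilinear : bilinear_map act;
  hom_actA : forall h g m,
    act (alpha h) (act g m) = act (mul h g) (mu m);
  hom_act1 : forall m, act one m = mu m;
  hom_act_aut : forall h m, mu (act h m) = act (alpha h) (mu m) }.

Record is_hom_module_algebra (H : lmodType k) (alpha : lin_aut H)
    (mulH : H -> H -> H) (oneH : H) (DeltaH : H -> H ⊗ H) (epsH : H -> k)
    (B : lmodType k) (beta : lin_aut B) (mulB : B -> B -> B) (oneB : B)
    (act : H -> B -> B) : Prop := {
  hom_modalg_alg : is_hom_algebra beta mulB oneB;
  hom_modalg_mod : is_hom_module alpha mulH oneH beta act;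
  hom_actM : forall h a b,
    act h (mulB a b) = \sw_(h1 ⊗ h2 <- DeltaH h) mulB (act h1 a) (act h2 b);
  hom_act_one : forall h, act h oneB = epsH h *: oneB }.

Record is_hom_comodule (C : lmodType k) (gamma : lin_aut C)
    (Delta : C -> C ⊗ C) (eps : C -> k)
    (M : lmodType k) (mu : lin_aut M) (rho : M -> M ⊗ C) : Prop := {
  hom_coact_linear : linear rho;
  hom_coactA : forall m,
    \sw_(m0 ⊗ m1 <- rho m) \sw_(m11 ⊗ m12 <- Delta m1)
      aut_inv mu m0 ⊗ (m11 ⊗ m12)
    = \sw_(m0 ⊗ m1 <- rho m) \sw_(m00 ⊗ m01 <- rho m0)
      m00 ⊗ (m01 ⊗ aut_inv gamma m1);
  hom_coact_counit : forall m,
    \sw_(m0 ⊗ m1 <- rho m) eps m1 *: m0 = aut_inv mu m;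
  hom_coact_aut : forall m,
    rho (mu m) = \sw_(m0 ⊗ m1 <- rho m) mu m0 ⊗ gamma m1 }.

Record is_hom_comodule_coalgebra (B : lmodType k) (beta : lin_aut B)
    (mulB : B -> B -> B) (oneB : B) (DeltaB : B -> B ⊗ B) (epsB : B -> k)
    (C : lmodType k) (gamma : lin_aut C) (DeltaC : C -> C ⊗ C) (epsC : C -> k)
    (rho : C -> C ⊗ B) : Prop := {
  hom_comodcoalg_coalg : is_hom_coalgebra gamma DeltaC epsC;
  hom_comodcoalg_comod : is_hom_comodule beta DeltaB epsB gamma rho;
  hom_coact_comul : forall c,
    \sw_(c0 ⊗ c1 <- rho c) \sw_(c01 ⊗ c02 <- DeltaC c0)
      c01 ⊗ (c02 ⊗ c1)
    = \sw_(c1 ⊗ c2 <- DeltaC c) \sw_(c10 ⊗ c11 <- rho c1)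
      \sw_(c20 ⊗ c21 <- rho c2) c10 ⊗ (c20 ⊗ mulB c11 c21);
  hom_coact_eps : forall c,
    \sw_(c0 ⊗ c1 <- rho c) epsC c0 *: c1 = epsC c *: oneB }.

Section Smash.
Variables (B H : lmodType k) (beta : lin_aut B) (alpha : lin_aut H).
Variables (mulB : B -> B -> B) (mulH : H -> H -> H).
Variables (DeltaB : B -> B ⊗ B) (DeltaH : H -> H ⊗ H).
Variables (epsB : B -> k) (epsH : H -> k).
Variables (act : H -> B -> B) (rho : H -> H ⊗ B).

Definition smash_mul (x y : B ⊗ H) : B ⊗ H :=
  \sw_(a ⊗ h <- x) \sw_(b ⊗ g <- y) \sw_(h1 ⊗ h2 <- DeltaH h)
    mulB a (act h1 (aut_inv beta b)) ⊗ mulH (alpha h2) g.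

Definition smash_comul (x : B ⊗ H) : (B ⊗ H) ⊗ (B ⊗ H) :=
  \sw_(a ⊗ h <- x) \sw_(a1 ⊗ a2 <- DeltaB a) \sw_(h1 ⊗ h2 <- DeltaH h)
  \sw_(h10 ⊗ h11 <- rho h1)
    (a1 ⊗ alpha h10) ⊗ (mulB (aut_inv beta a2) h11 ⊗ h2).

Definition smash_counit (x : B ⊗ H) : k :=
  (\sw_(a ⊗ h <- x) (epsB a * epsH h : k^o)).

End Smash.

End HomStructures.

(* Main.v *)
(* Untwisting reduces the statement to ordinary bialgebras: if alpha is the
   automorphism of a monoidal Hom-bialgebra, then alpha^-1(gh) and
   Delta(alpha(h)) are the product and coproduct of an ordinary bialgebra of
   which alpha is an automorphism. In the same way beta^-1(h . b) is an ordinary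
   module algebra structure and rho(alpha(h)) an ordinary comodule coalgebra
   structure; the Hom-smash product and coproduct become the ordinary ones, and
   each of the five conditions becomes its untwisted form.

   For ordinary bialgebras, B # H is always an algebra and a coalgebra, so only
   compatibility matters. Given the conditions, multiplicativity of the
   coproduct follows by expanding Delta(h . b) and rho(hk) with (1) and (5),
   and moving the coaction past the action with (4). Conversely, applying counits
   to two of the four legs of Delta((1 # h)(b # k)) = Delta(1 # h) Delta(b # k)
   yields (1), (4) and (5). *)
Require Import Defs.
From mathcomp Require Import all_boot all_order all_algebra.
From mathcomp Require Import boolp.

Set Implicit Arguments.
Unset Strict Implicit.
Unset Printing Implicit Defensive.

Import GRing.Theory.
Local Open Scope ring_scope.

(** * Sweedler sums and the linearity of expressions containing them *)

Section SweedlerSums.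
Variable k : fieldType.
Implicit Types U V W X : lmodType k.

Lemma linear_map0 U V (f : U -> V) : linear f -> f 0 = 0.
Proof.
move=> hf; have := hf 1 0 0; rewrite !scale1r addr0 => h.
by apply: (addrI (f 0)); rewrite addr0 -h.
Qed.

Lemma linear_map_sum U V (f : U -> V) (I : Type) (s : seq I) (F : I -> U) :
  linear f -> f (\sum_(i <- s) F i) = \sum_(i <- s) f (F i).
Proof.
move=> hf; elim: s => [|i s IHs]; first by rewrite !big_nil linear_map0.
by rewrite !big_cons -IHs -[F i in LHS]scale1r hf scale1r.
Qed.

(** A Sweedler sum is by definition a finite sum over a representative, so additivity of [f] is all
    that matters and [g] may be any function. For the same reason [exchange_sw] below asks no
    bilinearity. *)
Lemma linear_sw U V W X (f : W -> X) (g : U -> V -> W) (t : U ⊗ V) :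
  linear f -> f (\sw_(u ⊗ v <- t) g u v) = \sw_(u ⊗ v <- t) f (g u v).
Proof. exact: linear_map_sum. Qed.

Lemma sw_sw U V U' V' W (f : U -> V -> W) (g : U' -> V' -> U ⊗ V) t :
  bilinear_map f ->
  tlift f (\sw_(u ⊗ v <- t) g u v) = \sw_(u ⊗ v <- t) tlift f (g u v).
Proof. by move=> hf; apply: linear_sw; apply: tlift_linear. Qed.

Lemma eq_sw U V W (f g : U -> V -> W) (t : U ⊗ V) :
  (forall u v, f u v = g u v) -> tlift f t = tlift g t.
Proof. by move=> fg; apply: eq_bigr => p _; apply: fg. Qed.

Lemma exchange_sw U V U' V' W (f : U -> V -> U' -> V' -> W) t t' :
  \sw_(u ⊗ v <- t) \sw_(u' ⊗ v' <- t') f u v u' v'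
  = \sw_(u' ⊗ v' <- t') \sw_(u ⊗ v <- t) f u v u' v'.
Proof. exact: exchange_big. Qed.

Lemma sw_tens U V (t : U ⊗ V) : \sw_(u ⊗ v <- t) u ⊗ v = t.
Proof. by rewrite [RHS]tens_reprE. Qed.

Lemma sw_scale U V W (a : k) (f : U -> V -> W) t :
  \sw_(u ⊗ v <- t) a *: f u v = a *: \sw_(u ⊗ v <- t) f u v.
Proof. by rewrite /tlift /formal_eval scaler_sumr. Qed.

Lemma scaleCA U (a b : k) (u : U) : a *: (b *: u) = b *: (a *: u).
Proof. by rewrite !scalerA mulrC. Qed.

Lemma bilinP U V W (f : U -> V -> W) :
  (forall v, linear (fun u => f u v)) -> (forall u, linear (fun v => f u v)) ->
  bilinear_map f.
Proof. by []. Qed.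

Lemma linear_id U : linear (fun u : U => u).
Proof. by []. Qed.

Lemma linear_comp U V W (f : V -> W) (g : U -> V) :
  linear f -> linear g -> linear (fun u => f (g u)).
Proof. by move=> hf hg a u v; rewrite hg hf. Qed.

(* The codomain [k^o] of a linear form is not found by unification. *)
Lemma linear_form_comp U V (f : V -> k^o) (g : U -> V) :
  linear f -> linear g -> linear (fun u => f (g u) : k^o).
Proof. exact: linear_comp. Qed.

Lemma linear_bil U V W X (m : V -> W -> X) (g : U -> V) w :
  bilinear_map m -> linear g -> linear (fun u => m (g u) w).
Proof. by move=> hm hg a u v; rewrite hg bilinear_mapDl // bilinear_mapZl. Qed.

Lemma linear_bir U V W X (m : V -> W -> X) (g : U -> W) v :
  bilinear_map m -> linear g -> linear (fun u => m v (g u)).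
Proof. by move=> hm hg a u w; rewrite hg bilinear_mapDr // bilinear_mapZr. Qed.

Lemma linear_sw_body U V W X (f : X -> U -> V -> W) (t : U ⊗ V) :
  (forall u v, linear (fun x => f x u v)) ->
  linear (fun x => \sw_(u ⊗ v <- t) f x u v).
Proof.
move=> hf a x y; rewrite /tlift /formal_eval scaler_sumr -big_split.
by apply: eq_bigr => p _; apply: hf.
Qed.

Lemma linear_sw_source U V W X (f : U -> V -> W) (t : X -> U ⊗ V) :
  bilinear_map f -> linear t -> linear (fun x => tlift f (t x)).
Proof. by move=> hf; apply: linear_comp; apply: tlift_linear. Qed.

Lemma linear_scalel U V (g : U -> k^o) (w : V) :
  linear g -> linear (fun u => g u *: w).
Proof. by move=> hg a u v; rewrite hg scalerDl scalerA. Qed.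

Lemma linear_scaler U V (g : U -> V) (a : k) :
  linear g -> linear (fun u => a *: g u).
Proof. by move=> hg b u v; rewrite hg scalerDr !scalerA mulrC. Qed.

Lemma linear_mull U (g : U -> k^o) (b : k) :
  linear g -> linear (fun u => g u * b : k^o).
Proof. by move=> hg a u v; rewrite hg mulrDl /GRing.scale /= mulrA. Qed.

Lemma linear_mulr U (g : U -> k^o) (b : k) :
  linear g -> linear (fun u => b * g u : k^o).
Proof. by move=> hg a u v; rewrite hg mulrDr /GRing.scale /= mulrCA. Qed.

End SweedlerSums.

(** * Automation for linearity and for Sweedler sums *)

Ltac lin_fact :=
  first [ assumption | apply: linear_id | apply: tens_bilinear
        | apply: aut_linear | apply: aut_inv_linear
        | match goal with H : _ |- _ => solve [simple apply H] end ].

(** Recursion on the term under the binder. Sweedler sums are treated before general applications,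
    according to whether the variable occurs in the summand or in the tensor summed over; the later
    branches reach one argument of a map of several variables. *)
Ltac lin :=
  cbv beta;
  match goal with
  | _ => solve [lin_fact]
  | |- forall _, _ => intro; solve [lin]
  | |- bilinear_map _ => apply: bilinP => ?; solve [lin]
  | |- GRing.linear_for _ (fun x => @tlift _ _ _ ?W (@?f x) ?t) =>
      refine (linear_sw_body (W := W) (f := f) t _) => ? ?; solve [lin]
  | |- GRing.linear_for _ (fun x => @tlift _ _ _ ?W ?f (@?t x)) =>
      refine (linear_sw_source (W := W) (f := f) (t := t) _ _); solve [lin]
  | |- GRing.linear_for _ (fun x => ?m (@?g x) ?w) =>
      apply: (linear_bil (m := m) (g := g)); [solve [lin_fact] | solve [lin]]
  | |- GRing.linear_for _ (fun x => ?m ?v (@?g x)) =>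
      apply: (linear_bir (m := m) (g := g)); [solve [lin_fact] | solve [lin]]
  | |- GRing.linear_for _ (fun x => @GRing.scale _ _ (@?g x) ?w) =>
      refine (@linear_scalel _ _ _ g w _); solve [lin]
  | |- GRing.linear_for _ (fun x => @GRing.scale _ _ ?v (@?g x)) =>
      refine (@linear_scaler _ _ _ g v _); solve [lin]
  | |- GRing.linear_for _ (fun x => @GRing.mul _ (@?g x) ?w) =>
      refine (@linear_mull _ _ g w _); solve [lin]
  | |- GRing.linear_for _ (fun x => @GRing.mul _ ?v (@?g x)) =>
      refine (@linear_mulr _ _ g v _); solve [lin]
  | |- GRing.linear_for _ (fun x => ?m (@?g x) ?w) =>
      apply: (linear_comp (f := fun z => m z w) (g := g));
      [solve [lin_fact] | solve [lin]]
  | |- GRing.linear_for _ (fun x => ?m (@?g x) ?w ?w') =>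
      apply: (linear_comp (f := fun z => m z w w') (g := g));
      [solve [lin_fact] | solve [lin]]
  | |- GRing.linear_for _ (fun x => ?m (@?g x) ?w ?w' ?w'') =>
      apply: (linear_comp (f := fun z => m z w w' w'') (g := g));
      [solve [lin_fact] | solve [lin]]
  | |- GRing.linear_for _ (fun x => ?f (@?g x)) =>
      first [ apply: (linear_comp (f := f) (g := g))
            | refine (@linear_form_comp _ _ _ f g _ _) ];
      [solve [lin_fact] | solve [lin]]
  end.

(* Proves [e = ?z], where [?z] is [e] with the sums over sums and over pure
   tensors eliminated. *)
Ltac sw_nf :=
  cbv beta;
  lazymatch goal with
  | |- @tlift _ _ _ ?W ?f (tlift ?g ?t) = _ =>
      etransitivity; [refine (sw_sw (W := W) (f := f) g t _); lin | sw_nf]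
  | |- @tlift _ _ _ ?W ?f (tens ?u ?v) = _ =>
      etransitivity; [refine (tlift_tens (W := W) (f := f) _ u v); lin | sw_nf]
  | |- tlift _ _ = _ => apply: eq_sw => ? ?; sw_nf
  | |- _ => reflexivity
  end.

(* [sw_rw tac] rewrites, by [tac], the outermost Sweedler sum of the left-hand
   side on which [tac] succeeds, possibly under the binders of other sums. *)
Ltac sw_in tac := first [tac | apply: eq_sw => ? ?; sw_in tac].
Ltac sw_rw tac := etransitivity; [sw_in ltac:(tac; reflexivity) |].

(** Moves the sum over [t] outwards one exchange at a time; [t] must not depend on the variables
    bound by the sums it passes. *)
Ltac sw_front t := repeat sw_rw ltac:(refine (exchange_sw _ _ t)).

(** Closes a goal whose two sides are the normal forms of the two sides of [e]; [sw_nf_in] instead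
    replaces [e] by its normal form. *)
Ltac sw_from e :=
  etransitivity; [| etransitivity; [exact e | sw_nf]]; symmetry; sw_nf.

Ltac sw_nf_in e :=
  let e' := fresh in
  eassert (e' : _ = _) by (sw_from e); clear e; rename e' into e.

Section Coassoc.
Variables (k : fieldType) (C : lmodType k) (gamma : lin_aut C).
Variables (Delta : C -> C ⊗ C) (eps : C -> k).
Hypothesis hC : is_hom_coalgebra gamma Delta eps.

(** Coassociativity composed with the linear map that the trilinear [F] induces on the triple tensor
    product. In this form it can be rewritten inside larger sums, with the remaining factors
    absorbed into [F]. *)
Lemma coassocF (W : lmodType k) (F : C -> C -> C -> W) :
  (forall y z, linear (fun x => F x y z)) ->
  (forall x z, linear (fun y => F x y z)) ->
  (forall x y, linear (fun z => F x y z)) -> forall c,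
  \sw_(c1 ⊗ c2 <- Delta c) \sw_(c21 ⊗ c22 <- Delta c2)
      F (aut_inv gamma c1) c21 c22
  = \sw_(c1 ⊗ c2 <- Delta c) \sw_(c11 ⊗ c12 <- Delta c1)
      F c11 c12 (aut_inv gamma c2).
Proof.
move=> h1 h2 h3 c.
have := congr1 (tlift (fun x t => \sw_(y ⊗ z <- t) F x y z)) (hom_coassoc hC c).
by move=> e; sw_from e.
Qed.

End Coassoc.

(** Two linear maps on a tensor product agree as soon as they agree on pure tensors; this reduces a
    goal about [x] to that case. *)
Ltac tens_elim x :=
  revert x;
  lazymatch goal with |- forall x, @?f x = @?g x =>
    apply: (@tens_ext _ _ _ _ f g); [lin | lin | cbv beta] end.

Lemma tens_sw (k : fieldType) (U V U' V' W X : lmodType k)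
    (f : U -> V -> W) (g : U' -> V' -> X) t t' :
  (\sw_(u ⊗ v <- t) f u v) ⊗ (\sw_(u ⊗ v <- t') g u v)
  = \sw_(u ⊗ v <- t) \sw_(u' ⊗ v' <- t') f u v ⊗ g u' v'.
Proof.
rewrite (linear_sw (f := fun w => w ⊗ _)); last by lin.
apply: eq_sw => u v; rewrite (linear_sw (f := fun w => f u v ⊗ w)) //; lin.
Qed.

Lemma sw_counit (k : fieldType) (U V W X : lmodType k) (e : U -> V -> k)
    (f : U -> V -> W) (F : W -> X) t w :
  linear F -> \sw_(u ⊗ v <- t) e u v *: f u v = w ->
  \sw_(u ⊗ v <- t) e u v *: F (f u v) = F w.
Proof.
move=> hF <-; rewrite linear_sw //; apply: eq_sw => u v.
(* Linearity with 0 as the second vector is homogeneity. *)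
by have := hF (e u v) (f u v) 0; rewrite !addr0 (linear_map0 hF) addr0.
Qed.

(** Hom-structures over [id_aut] are the ordinary ones, so the ordinary theorem is stated with the
    same records and the same smash operations. *)
Definition id_aut (k : fieldType) (V : lmodType k) : lin_aut V :=
  @LinAut k V (fun v => v) (fun v => v) (@linear_id k V)
    (fun v => erefl v) (fun v => erefl v).

Arguments id_aut {k} V%_type.

(** * The untwisted theorem *)

Section Ordinary.
Variables (k : fieldType) (B H : lmodType k).
Variables (mulB : B -> B -> B) (oneB : B) (DeltaB : B -> B ⊗ B) (epsB : B -> k).
Variables (mulH : H -> H -> H) (oneH : H) (DeltaH : H -> H ⊗ H) (epsH : H -> k).
Variables (act : H -> B -> B) (rho : H -> H ⊗ B).
Hypothesis bialgB : is_hom_bialgebra (id_aut B) mulB oneB DeltaB epsB.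
Hypothesis bialgH : is_hom_bialgebra (id_aut H) mulH oneH DeltaH epsH.
Hypothesis modB : is_hom_module_algebra (id_aut H) mulH oneH DeltaH epsH
  (id_aut B) mulB oneB act.
Hypothesis comodH : is_hom_comodule_coalgebra (id_aut B) mulB oneB DeltaB epsB
  (id_aut H) DeltaH epsH rho.

Let mB := hom_mul_bilinear (hom_bialg_alg bialgB).
Let mH := hom_mul_bilinear (hom_bialg_alg bialgH).
Let mA := hom_act_bilinear (hom_modalg_mod modB).
Let dB := hom_comul_linear (hom_bialg_coalg bialgB).
Let dH := hom_comul_linear (hom_bialg_coalg bialgH).
Let dR := hom_coact_linear (hom_comodcoalg_comod comodH).
Let eB : linear (epsB : B -> k^o) := hom_counit_linear (hom_bialg_coalg bialgB).
Let eH : linear (epsH : H -> k^o) := hom_counit_linear (hom_bialg_coalg bialgH).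

(** Over [id_aut] the twists compute away, and each Hom-axiom is convertible to the usual axiom. *)
Let mulBA a b c : mulB a (mulB b c) = mulB (mulB a b) c.
Proof. exact: (hom_mulA (hom_bialg_alg bialgB)). Qed.
Let mulHA a b c : mulH a (mulH b c) = mulH (mulH a b) c.
Proof. exact: (hom_mulA (hom_bialg_alg bialgH)). Qed.
Let mulB1 a : mulB a oneB = a.
Proof. exact: (hom_mulr1 (hom_bialg_alg bialgB)). Qed.
Let mulH1 a : mulH a oneH = a.
Proof. exact: (hom_mulr1 (hom_bialg_alg bialgH)). Qed.
Let mul1B a : mulB oneB a = a.
Proof. exact: (hom_mul1r (hom_bialg_alg bialgB)). Qed.
Let mul1H a : mulH oneH a = a.
Proof. exact: (hom_mul1r (hom_bialg_alg bialgH)). Qed.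
Let actA h g b : act h (act g b) = act (mulH h g) b.
Proof. exact: (hom_actA (hom_modalg_mod modB)). Qed.
Let act1 b : act oneH b = b.
Proof. exact: (hom_act1 (hom_modalg_mod modB)). Qed.
Let act_one h : act h oneB = epsH h *: oneB.
Proof. exact: (hom_act_one modB). Qed.
Let epsB1 := hom_counit1 bialgB.
Let epsH1 := hom_counit1 bialgH.
Let epsBM := hom_counitM bialgB.
Let epsHM := hom_counitM bialgH.
Let DeltaB1 := hom_comul1 bialgB.
Let DeltaH1 := hom_comul1 bialgH.

(** * The axioms of bialgebras, module algebras and comodule coalgebras under multilinear maps *)

Section Multilinear.
Variable W : lmodType k.

Lemma counitrH (F : H -> W) h : linear F ->
  \sw_(h1 ⊗ h2 <- DeltaH h) epsH h2 *: F h1 = F h.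
Proof.
by move=> hF; apply: (sw_counit hF); apply: (hom_counitr (hom_bialg_coalg bialgH)).
Qed.

Lemma counitlH (F : H -> W) h : linear F ->
  \sw_(h1 ⊗ h2 <- DeltaH h) epsH h1 *: F h2 = F h.
Proof.
by move=> hF; apply: (sw_counit hF); apply: (hom_counitl (hom_bialg_coalg bialgH)).
Qed.

Lemma counitrB (F : B -> W) b : linear F ->
  \sw_(b1 ⊗ b2 <- DeltaB b) epsB b2 *: F b1 = F b.
Proof.
by move=> hF; apply: (sw_counit hF); apply: (hom_counitr (hom_bialg_coalg bialgB)).
Qed.

Lemma counitlB (F : B -> W) b : linear F ->
  \sw_(b1 ⊗ b2 <- DeltaB b) epsB b1 *: F b2 = F b.
Proof.
by move=> hF; apply: (sw_counit hF); apply: (hom_counitl (hom_bialg_coalg bialgB)).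
Qed.

Lemma coact_counitr (F : H -> W) h : linear F ->
  \sw_(h0 ⊗ h1 <- rho h) epsB h1 *: F h0 = F h.
Proof.
move=> hF; apply: (sw_counit hF).
exact: (hom_coact_counit (hom_comodcoalg_comod comodH)).
Qed.

Lemma coact_counitl (F : B -> W) h : linear F ->
  \sw_(h0 ⊗ h1 <- rho h) epsH h0 *: F h1 = epsH h *: F oneB.
Proof.
move=> hF.
transitivity (F (epsH h *: oneB)).
  by apply: (sw_counit hF); apply: (hom_coact_eps comodH).
by have := hF (epsH h) oneB 0; rewrite !addr0 (linear_map0 hF) addr0.
Qed.

Lemma coassocH (F : H -> H -> H -> W) :
  (forall y z, linear (fun x => F x y z)) ->
  (forall x z, linear (fun y => F x y z)) ->
  (forall x y, linear (fun z => F x y z)) -> forall c,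
  \sw_(c1 ⊗ c2 <- DeltaH c) \sw_(x ⊗ y <- DeltaH c2) F c1 x y
  = \sw_(c1 ⊗ c2 <- DeltaH c) \sw_(x ⊗ y <- DeltaH c1) F x y c2.
Proof. exact: (coassocF (hom_bialg_coalg bialgH)). Qed.

Lemma coassocB (F : B -> B -> B -> W) :
  (forall y z, linear (fun x => F x y z)) ->
  (forall x z, linear (fun y => F x y z)) ->
  (forall x y, linear (fun z => F x y z)) -> forall c,
  \sw_(c1 ⊗ c2 <- DeltaB c) \sw_(x ⊗ y <- DeltaB c2) F c1 x y
  = \sw_(c1 ⊗ c2 <- DeltaB c) \sw_(x ⊗ y <- DeltaB c1) F x y c2.
Proof. exact: (coassocF (hom_bialg_coalg bialgB)). Qed.

Lemma coactA (F : H -> B -> B -> W) :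
  (forall y z, linear (fun x => F x y z)) ->
  (forall x z, linear (fun y => F x y z)) ->
  (forall x y, linear (fun z => F x y z)) -> forall h,
  \sw_(h0 ⊗ h1 <- rho h) \sw_(x ⊗ y <- DeltaB h1) F h0 x y
  = \sw_(h0 ⊗ h1 <- rho h) \sw_(x ⊗ y <- rho h0) F x y h1.
Proof.
move=> h1 h2 h3 h.
have e := congr1 (tlift (fun x t => \sw_(y ⊗ z <- t) F x y z))
  (hom_coactA (hom_comodcoalg_comod comodH) h).
by sw_from e.
Qed.

Lemma coact_comul (F : H -> H -> B -> W) :
  (forall y z, linear (fun x => F x y z)) ->
  (forall x z, linear (fun y => F x y z)) ->
  (forall x y, linear (fun z => F x y z)) -> forall h,
  \sw_(h0 ⊗ h1 <- rho h) \sw_(x ⊗ y <- DeltaH h0) F x y h1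
  = \sw_(h1 ⊗ h2 <- DeltaH h) \sw_(x0 ⊗ x1 <- rho h1) \sw_(y0 ⊗ y1 <- rho h2)
      F x0 y0 (mulB x1 y1).
Proof.
move=> h1 h2 h3 h.
have e := congr1 (tlift (fun x t => \sw_(y ⊗ z <- t) F x y z))
  (hom_coact_comul comodH h).
by sw_from e.
Qed.

Lemma comulBM (F : B -> B -> W) : bilinear_map F -> forall a b,
  \sw_(x ⊗ y <- DeltaB (mulB a b)) F x y
  = \sw_(a1 ⊗ a2 <- DeltaB a) \sw_(b1 ⊗ b2 <- DeltaB b)
      F (mulB a1 b1) (mulB a2 b2).
Proof. by move=> hF a b; rewrite (hom_comulM bialgB) /tens_mul; sw_nf. Qed.

Lemma comulHM (F : H -> H -> W) : bilinear_map F -> forall a b,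
  \sw_(x ⊗ y <- DeltaH (mulH a b)) F x y
  = \sw_(a1 ⊗ a2 <- DeltaH a) \sw_(b1 ⊗ b2 <- DeltaH b)
      F (mulH a1 b1) (mulH a2 b2).
Proof. by move=> hF a b; rewrite (hom_comulM bialgH) /tens_mul; sw_nf. Qed.

Lemma actM (F : B -> W) : linear F -> forall h a b,
  F (act h (mulB a b)) = \sw_(h1 ⊗ h2 <- DeltaH h) F (mulB (act h1 a) (act h2 b)).
Proof. by move=> hF h a b; rewrite (hom_actM modB) linear_sw. Qed.

End Multilinear.

(** * The ordinary smash product algebra and smash coproduct coalgebra *)

Let smul := smash_mul (id_aut B) (id_aut H) mulB mulH DeltaH act.
Let scom := smash_comul (id_aut B) (id_aut H) mulB DeltaB DeltaH rho.
Let seps := smash_counit epsB epsH.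

Lemma smulE a h b g : smul (a ⊗ h) (b ⊗ g) =
  \sw_(h1 ⊗ h2 <- DeltaH h) mulB a (act h1 b) ⊗ mulH h2 g.
Proof. by rewrite /smul /smash_mul; sw_nf. Qed.

Lemma scomE a h : scom (a ⊗ h) =
  \sw_(a1 ⊗ a2 <- DeltaB a) \sw_(h1 ⊗ h2 <- DeltaH h)
  \sw_(p ⊗ q <- rho h1) (a1 ⊗ p) ⊗ (mulB a2 q ⊗ h2).
Proof. by rewrite /scom /smash_comul; sw_nf. Qed.

Lemma sepsE a h : seps (a ⊗ h) = epsB a * epsH h.
Proof. by rewrite /seps /smash_counit; sw_nf. Qed.

Let mS : bilinear_map smul.
Proof. rewrite /smul /smash_mul /=; lin. Qed.
Let dS : linear scom.
Proof. rewrite /scom /smash_comul /=; lin. Qed.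
Let eS : linear (seps : B ⊗ H -> k^o).
Proof. rewrite /seps /smash_counit /=; lin. Qed.

(** For associativity, one bracketing is expanded by the module algebra axiom [actM], the other by
    multiplicativity and coassociativity of [DeltaH]; they meet in one sum over the legs of [h] and
    [g]. *)
Lemma smash_algebra : is_hom_algebra (id_aut (B ⊗ H)) smul (oneB ⊗ oneH).
Proof.
split => //=.
- move=> x y z; tens_elim x => a h; tens_elim y => b g; tens_elim z => c l.
  transitivity (\sw_(h1 ⊗ h2 <- DeltaH h) \sw_(x ⊗ y <- DeltaH h1)
    \sw_(g1 ⊗ g2 <- DeltaH g)
      mulB a (mulB (act x b) (act (mulH y g1) c)) ⊗ mulH h2 (mulH g2 l)).
  + rewrite /smul /smash_mul; etransitivity; [sw_nf|] => /=.
    etransitivity; [exact: exchange_sw|]; apply: eq_sw => h1 h2; rewrite [RHS]exchange_sw.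
    apply: eq_sw => g1 g2.
    rewrite (actM (F := fun z => mulB a z ⊗ _)); last by lin.
    by apply: eq_sw => x y; rewrite actA.
  + rewrite /smul /smash_mul; symmetry; etransitivity; [sw_nf|] => /=.
    sw_rw ltac:(rewrite comulHM; last by lin).
    etransitivity; [refine (coassocH _ _ _ _); lin |].
    do 3 apply: eq_sw => ? ?.
    by rewrite !mulBA !mulHA.
- move=> x; tens_elim x => u v; rewrite smulE.
  under eq_sw => h1 h2 do rewrite act_one mulH1 (bilinear_mapZr mB) mulB1
    (bilinear_mapZl (@tens_bilinear _ _ _)).
  by rewrite (counitlH (F := fun z => u ⊗ z)) //; lin.
- move=> x; tens_elim x => u v; rewrite smulE DeltaH1.
  etransitivity; [sw_nf|].
  by rewrite act1 mul1B mul1H.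
Qed.

(** Dual to associativity: multiplicativity of [DeltaB] and coassociativity of [DeltaH] bring the
    left-hand side to the common sum, while the right-hand side needs the comodule coalgebra
    axioms. *)
Lemma smash_coassoc x :
  \sw_(c1 ⊗ c2 <- scom x) \sw_(c21 ⊗ c22 <- scom c2) c1 ⊗ (c21 ⊗ c22)
  = \sw_(c1 ⊗ c2 <- scom x) \sw_(c11 ⊗ c12 <- scom c1) c11 ⊗ (c12 ⊗ c2).
Proof.
tens_elim x => a h.
transitivity (\sw_(a1 ⊗ a2 <- DeltaB a) \sw_(a21 ⊗ a22 <- DeltaB a2)
  \sw_(h1 ⊗ h2 <- DeltaH h) \sw_(x ⊗ y <- DeltaH h1)
  \sw_(p ⊗ q <- rho x) \sw_(q1 ⊗ q2 <- DeltaB q) \sw_(u ⊗ v <- rho y)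
  (a1 ⊗ p) ⊗ ((mulB a21 q1 ⊗ u) ⊗ (mulB a22 (mulB q2 v) ⊗ h2))).
  rewrite /scom /smash_comul; etransitivity; [sw_nf|] => /=.
  apply: eq_sw => a1 a2.
  sw_rw ltac:(rewrite comulBM; last by lin).
  sw_rw ltac:(refine (exchange_sw _ (rho _) (DeltaB a2))).
  sw_rw ltac:(refine (exchange_sw _ (DeltaH h) (DeltaB a2))).
  apply: eq_sw => a21 a22.
  sw_rw ltac:(refine (exchange_sw _ (DeltaB _) (DeltaH _))).
  sw_rw ltac:(refine (exchange_sw _ (rho _) (DeltaH _))).
  etransitivity; [refine (coassocH _ _ _ _); lin |].
  do 5 apply: eq_sw => ? ?.
  by rewrite mulBA.
(* From the other side: [coact_comul] splits the coaction over the two legs of [h1], and [coactA]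
   turns the repeated coaction into a coproduct in [B]. *)
rewrite /scom /smash_comul; symmetry; etransitivity; [sw_nf|] => /=.
sw_rw ltac:(refine (exchange_sw _ (rho _) (DeltaB _))).
sw_rw ltac:(refine (exchange_sw _ (DeltaH _) (DeltaB _))).
etransitivity; [refine (esym (coassocB _ _ _ _)); lin |].
do 3 apply: eq_sw => ? ?.
sw_rw ltac:(refine (coact_comul _ _ _ _); lin).
do 1 apply: eq_sw => ? ?.
sw_rw ltac:(refine (exchange_sw _ (rho _) (rho _))).
sw_rw ltac:(refine (esym (coactA _ _ _ _)); lin).
rewrite exchange_sw; apply: eq_sw => ? ?.
by rewrite exchange_sw.
Qed.

Lemma smash_counitr x : \sw_(c1 ⊗ c2 <- scom x) seps c2 *: c1 = x.
Proof.
tens_elim x => a h; rewrite scomE; etransitivity; [sw_nf|].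
(* The three counit factors are nested in the order in which their sums will disappear: [rho], then
   [DeltaH], then [DeltaB]. *)
under eq_sw => a1 a2 do under eq_sw => h1 h2 do under eq_sw => p q do
  rewrite sepsE epsBM mulrAC mulrC [X in _ * X]mulrC -!scalerA.
sw_rw ltac:(refine (coact_counitr _ _); lin).
sw_rw ltac:(refine (counitrH _ _); lin).
by rewrite (counitrB (F := fun z => z ⊗ h)) //; lin.
Qed.

Lemma smash_counitl x : \sw_(c1 ⊗ c2 <- scom x) seps c1 *: c2 = x.
Proof.
tens_elim x => a h; rewrite scomE; etransitivity; [sw_nf|].
under eq_sw => a1 a2 do under eq_sw => h1 h2 do under eq_sw => p q do
  rewrite sepsE mulrC -!scalerA.
sw_rw ltac:(refine (coact_counitl _ _); lin).
sw_rw ltac:(refine (counitlH _ _); lin).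
under eq_sw => a1 a2 do rewrite mulB1.
by rewrite (counitlB (F := fun z => z ⊗ h)) //; lin.
Qed.

Lemma smash_coalgebra : is_hom_coalgebra (id_aut (B ⊗ H)) scom seps.
Proof.
split => //=.
- exact: smash_coassoc.
- exact: smash_counitr.
- exact: smash_counitl.
- by move=> c; rewrite sw_tens.
Qed.

(** Together with [mul_smash_comul], this expands both sides of multiplicativity on pure tensors;
    both directions of the equivalence start from the two expansions. *)
Lemma smash_comul_smash_mul a h b g : scom (smul (a ⊗ h) (b ⊗ g)) =
  \sw_(h1 ⊗ h2 <- DeltaH h) \sw_(a1 ⊗ a2 <- DeltaB a)
  \sw_(c1 ⊗ c2 <- DeltaB (act h1 b)) \sw_(s ⊗ t <- DeltaH h2)
  \sw_(g1 ⊗ g2 <- DeltaH g) \sw_(u ⊗ v <- rho (mulH s g1))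
    (mulB a1 c1 ⊗ u) ⊗ (mulB (mulB a2 c2) v ⊗ mulH t g2).
Proof.
rewrite smulE /scom /smash_comul; etransitivity; [sw_nf|] => /=.
sw_rw ltac:(rewrite comulBM; last by lin).
by sw_rw ltac:(rewrite comulHM; last by lin).
Qed.

Lemma mul_smash_comul a h b g :
  tens_mul smul smul (scom (a ⊗ h)) (scom (b ⊗ g)) =
  \sw_(a1 ⊗ a2 <- DeltaB a) \sw_(b1 ⊗ b2 <- DeltaB b)
  \sw_(g1 ⊗ g2 <- DeltaH g) \sw_(m ⊗ n <- rho g1)
  \sw_(h1 ⊗ h2 <- DeltaH h) \sw_(p ⊗ q <- rho h1)
  \sw_(p1 ⊗ p2 <- DeltaH p) \sw_(u ⊗ v <- DeltaH h2)
    (mulB a1 (act p1 b1) ⊗ mulH p2 m)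
    ⊗ (mulB (mulB a2 q) (act u (mulB b2 n)) ⊗ mulH v g2).
Proof.
rewrite !scomE /tens_mul; etransitivity; [sw_nf|].
apply: eq_sw => a1 a2.
sw_front (DeltaB b); apply: eq_sw => b1 b2.
sw_front (DeltaH g); apply: eq_sw => g1 g2.
sw_front (rho g1); apply: eq_sw => m n.
do 2 apply: eq_sw => ? ?.
by rewrite !smulE tens_sw.
Qed.

(** * Sufficiency of the five conditions for ordinary bialgebras *)

Section Conditions.
Hypothesis comul_act : forall h b, DeltaB (act h b) =
  \sw_(h1 ⊗ h2 <- DeltaH h) \sw_(h10 ⊗ h11 <- rho h1)
  \sw_(b1 ⊗ b2 <- DeltaB b) act h10 b1 ⊗ mulB h11 (act h2 b2).
Hypothesis counit_act : forall h b, epsB (act h b) = epsH h * epsB b.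
Hypothesis coact1 : rho oneH = oneH ⊗ oneB.
Hypothesis coact_act : forall h b,
  \sw_(h1 ⊗ h2 <- DeltaH h) \sw_(h20 ⊗ h21 <- rho h2)
    h20 ⊗ mulB (act h1 b) h21
  = \sw_(h1 ⊗ h2 <- DeltaH h) \sw_(h10 ⊗ h11 <- rho h1)
    h10 ⊗ mulB h11 (act h2 b).
Hypothesis coactM : forall h g, rho (mulH h g) =
  \sw_(h1 ⊗ h2 <- DeltaH h) \sw_(h10 ⊗ h11 <- rho h1)
  \sw_(g0 ⊗ g1 <- rho g) mulH h10 g0 ⊗ mulB h11 (act h2 g1).

Lemma coact_actF (W : lmodType k) (F : H -> B -> W) : bilinear_map F ->
  forall h b,
  \sw_(h1 ⊗ h2 <- DeltaH h) \sw_(u ⊗ v <- rho h2) F u (mulB (act h1 b) v)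
  = \sw_(h1 ⊗ h2 <- DeltaH h) \sw_(u ⊗ v <- rho h1) F u (mulB v (act h2 b)).
Proof.
move=> hF h b; have e := congr1 (tlift F) (coact_act h b).
by sw_from e.
Qed.

(** Two groupings of the four legs of the iterated coproduct. The second makes the first two legs
    the coproduct of a single element, to which [coact_act] applies. *)
Lemma coassoc4 (W : lmodType k) (G : H -> H -> H -> H -> W) h :
  (forall y z w, linear (fun x => G x y z w)) ->
  (forall x z w, linear (fun y => G x y z w)) ->
  (forall x y w, linear (fun z => G x y z w)) ->
  (forall x y z, linear (fun w => G x y z w)) ->
  \sw_(c ⊗ d <- DeltaH h) \sw_(d1 ⊗ d2 <- DeltaH d) \sw_(r ⊗ s <- DeltaH d1)
    G c r s d2
  = \sw_(e ⊗ d <- DeltaH h) \sw_(c ⊗ r <- DeltaH e) \sw_(s ⊗ w <- DeltaH d)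
    G c r s w.
Proof.
move=> h1 h2 h3 h4.
sw_rw ltac:(refine (esym (coassocH _ _ _ _)); lin).
by etransitivity; [refine (coassocH _ _ _ _); lin |].
Qed.

(* The heart of the multiplicativity of the smash coproduct. In Sweedler
   notation the legs on the left-hand side are
   [h1_(0), h3_(0), h1_(1) (h2 . x) h3_(1) (h4 . y), h5]; [coact_act] swaps the
   middle factors into [h1_(1) h2_(1) (h3 . x) (h4 . y)]. *)
Lemma comul_key (W : lmodType k) (F : H -> H -> B -> H -> W) h x y :
  (forall y z w, linear (fun x => F x y z w)) ->
  (forall x z w, linear (fun y => F x y z w)) ->
  (forall x y w, linear (fun z => F x y z w)) ->
  (forall x y z, linear (fun w => F x y z w)) ->
  \sw_(h1 ⊗ h2 <- DeltaH h) \sw_(h11 ⊗ h12 <- DeltaH h1)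
  \sw_(p ⊗ q <- rho h11) \sw_(h21 ⊗ h22 <- DeltaH h2)
  \sw_(r ⊗ s <- DeltaH h21) \sw_(u ⊗ v <- rho r)
    F p u (mulB (mulB q (act h12 x)) (mulB v (act s y))) h22
  = \sw_(h1 ⊗ h2 <- DeltaH h) \sw_(p ⊗ q <- rho h1)
    \sw_(p1 ⊗ p2 <- DeltaH p) \sw_(u ⊗ v <- DeltaH h2)
      F p1 p2 (mulB q (act u (mulB x y))) v.
Proof.
move=> h1 h2 h3 h4.
(* Coassociativity gathers the leg acting on [x] and the next coacted leg as the coproduct [c ⊗ r]
   of one element [e]. *)
transitivity (\sw_(h1 ⊗ h2 <- DeltaH h) \sw_(p ⊗ q <- rho h1)
  \sw_(e ⊗ d <- DeltaH h2) \sw_(c ⊗ r <- DeltaH e) \sw_(u ⊗ v <- rho r)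
  \sw_(s ⊗ w <- DeltaH d)
    F p u (mulB q (mulB (mulB (act c x) v) (act s y))) w).
  etransitivity; [refine (esym (coassocH _ _ _ _)); lin |].
  apply: eq_sw => h' h''; rewrite exchange_sw; apply: eq_sw => p q.
  etransitivity; [refine (coassoc4 _ _ _ _ _); lin |].
  do 2 apply: eq_sw => ? ?.
  rewrite exchange_sw; apply: eq_sw => ? ?; apply: eq_sw => ? ?.
  by rewrite !mulBA.
(* After the swap the two actions are adjacent, on consecutive legs, and [actM] merges them into one
   action on [mulB x y]. *)
transitivity (\sw_(h1 ⊗ h2 <- DeltaH h) \sw_(p ⊗ q <- rho h1)
  \sw_(c ⊗ d <- DeltaH h2) \sw_(u ⊗ v <- rho c) \sw_(s ⊗ w <- DeltaH d)
    F p u (mulB (mulB q v) (act s (mulB x y))) w).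
  apply: eq_sw => h' h''; apply: eq_sw => p q.
  transitivity (\sw_(e ⊗ d <- DeltaH h'') \sw_(e1 ⊗ e2 <- DeltaH e)
    \sw_(s ⊗ w <- DeltaH d) \sw_(u ⊗ v <- rho e1)
    F p u (mulB q (mulB v (mulB (act e2 x) (act s y)))) w).
    apply: eq_sw => e d.
    etransitivity; [refine (coact_actF (F := fun u z => \sw_(s ⊗ w <- DeltaH d)
      F p u (mulB q (mulB z (act s y))) w) _ _ _); lin |].
    apply: eq_sw => e1 e2; rewrite exchange_sw.
    by do 2 apply: eq_sw => ? ?; rewrite !mulBA.
  etransitivity; [refine (esym (coassoc4 _ _ _ _ _)); lin |].
  apply: eq_sw => c d; rewrite [RHS]exchange_sw; apply: eq_sw => s w.
  rewrite exchange_sw; apply: eq_sw => u v.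
  rewrite (actM (F := fun z => F p u (mulB (mulB q v) z) w)); last by lin.
  by apply: eq_sw => ? ?; rewrite !mulBA.
(* On the right-hand side, [coact_comul] replaces the coproduct of [p] by coactions on the two legs
   of [h1], whose [B]-parts multiply to the same product [mulB q v]. *)
symmetry.
sw_rw ltac:(refine (coact_comul (F := fun x0 y0 z => \sw_(u ⊗ v <- DeltaH _)
  F x0 y0 (mulB z (act u (mulB x y))) v) _ _ _ _); lin).
symmetry; sw_rw ltac:(refine (exchange_sw _ (rho _) (DeltaH _))).
by etransitivity; [refine (coassocH _ _ _ _); lin |].
Qed.

Lemma smash_comulM x y :
  scom (smul x y) = tens_mul smul smul (scom x) (scom y).
Proof.
have lM : bilinear_map (tens_mul smul smul).
  by rewrite /tens_mul; lin.
tens_elim x => a h; tens_elim y => b g.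
rewrite mul_smash_comul smash_comul_smash_mul.
sw_rw ltac:(rewrite comul_act; sw_nf).
sw_rw ltac:(rewrite coactM; sw_nf).
sw_front (DeltaB a); apply: eq_sw => a1 a2.
sw_front (DeltaB b); apply: eq_sw => b1 b2.
sw_front (DeltaH g); apply: eq_sw => g1 g2.
sw_front (rho g1); apply: eq_sw => m n.
(* Once the sums over [a], [b], [g] and [rho g1] are matched, only the legs of [h] differ; this is
   [comul_key] with [b2] and [n] as the elements acted on. *)
have e := comul_key (F := fun p u z w =>
  (mulB a1 (act p b1) ⊗ mulH u m) ⊗ (mulB a2 z ⊗ mulH w g2)) h b2 n.
under [RHS]eq_sw => ? ? do under eq_sw => ? ? do under eq_sw => ? ? do
  under eq_sw => ? ? do rewrite -mulBA.
etransitivity; [|apply: e; lin].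
do 6 apply: eq_sw => ? ?.
by rewrite !mulBA.
Qed.

Lemma smash_bialgebra :
  is_hom_bialgebra (id_aut (B ⊗ H)) smul (oneB ⊗ oneH) scom seps.
Proof.
split.
- exact: smash_algebra.
- exact: smash_coalgebra.
- exact: smash_comulM.
- rewrite scomE DeltaB1 DeltaH1; etransitivity; [sw_nf|].
  by rewrite coact1; etransitivity; [sw_nf|]; rewrite mulB1.
- move=> x y; have lx : linear (fun x => seps (smul x y) : k^o) by lin.
  have ly u : linear (fun y => seps (smul u y) : k^o) by lin.
  have lx' : linear (fun x => seps x * seps y : k^o) by lin.
  have ly' u : linear (fun y => seps u * seps y : k^o) by lin.
  apply: (tens_ext lx lx') => a h; apply: (tens_ext (ly _) (ly' _)) => b g.
  rewrite smulE (linear_sw (f := seps : _ -> k^o)) // !sepsE.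
  under eq_sw => h1 h2 do rewrite sepsE epsBM epsHM counit_act.
  (* By [counit_act] the factor [epsH h1] splits off, and the counit axiom then collapses the sum
     over [h]. *)
  transitivity (epsB a * epsB b * (\sw_(h1 ⊗ h2 <- DeltaH h)
    (epsH h1 *: (epsH h2 * epsH g : k^o)))).
    rewrite -[X in _ = X]/((epsB a * epsB b) *: (_ : k^o)).
    rewrite (linear_sw (f := fun z : k^o => (epsB a * epsB b) *: z)); last by lin.
    apply: eq_sw => h1 h2; rewrite /GRing.scale /=.
    by rewrite !mulrA; congr (_ * _ * _); rewrite mulrAC.
  rewrite (counitlH (W := k^o) (F := fun z => epsH z * epsH g)); last by lin.
  by rewrite mulrACA.
- by rewrite sepsE epsB1 epsH1 mulr1.
Qed.

End Conditions.

(** * Necessity of the five conditions for ordinary bialgebras *)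

Section Converse.
Hypothesis bialgS : is_hom_bialgebra (id_aut (B ⊗ H)) smul (oneB ⊗ oneH) scom seps.

(** Evaluate the counit of [(1 # h)(b # 1)] both by multiplicativity and by expanding the
    product. *)
Lemma smash_counit_act h b : epsB (act h b) = epsH h * epsB b.
Proof.
have := hom_counitM bialgS (oneB ⊗ h) (b ⊗ oneH).
rewrite smulE !sepsE (linear_sw (f := seps : _ -> k^o)) // epsB1 epsH1 mul1r mulr1.
move=> <-.
under eq_sw => h1 h2 do rewrite sepsE mul1B mulH1 mulrC.
by rewrite (counitrH (W := k^o) (F := fun z => epsB (act z b))) //; lin.
Qed.

(** In the coproduct of the unit, [epsB] on the first leg and [epsH] on the last leave exactly the
    coaction of [oneH]. *)
Lemma smash_coact1 : rho oneH = oneH ⊗ oneB.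
Proof.
have := hom_comul1 bialgS; rewrite scomE DeltaB1 DeltaH1 => e0.
have e := congr1 (tlift (fun X Y => \sw_(x ⊗ y <- X) \sw_(z ⊗ w <- Y)
  epsB x *: (epsH w *: (y ⊗ z)))) e0.
sw_nf_in e; rewrite epsB1 epsH1 !scale1r in e; rewrite -e.
under eq_sw => ? ? do rewrite !scale1r mul1B.
by rewrite sw_tens.
Qed.

(* [F] applied to [Delta ((1 # h) (b # g)) = Delta (1 # h) Delta (b # g)];
   counits in two of the four arguments of [F] then give the conditions. *)
Let comulMF (W : lmodType k) (F : B -> H -> B -> H -> W) :
  (forall y z w, linear (fun x => F x y z w)) ->
  (forall x z w, linear (fun y => F x y z w)) ->
  (forall x y w, linear (fun z => F x y z w)) ->
  (forall x y z, linear (fun w => F x y z w)) -> forall h b g,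
  \sw_(h1 ⊗ h2 <- DeltaH h) \sw_(c1 ⊗ c2 <- DeltaB (act h1 b))
  \sw_(s ⊗ t <- DeltaH h2) \sw_(g1 ⊗ g2 <- DeltaH g)
  \sw_(u ⊗ v <- rho (mulH s g1)) F c1 u (mulB c2 v) (mulH t g2)
  = \sw_(b1 ⊗ b2 <- DeltaB b) \sw_(g1 ⊗ g2 <- DeltaH g)
    \sw_(m ⊗ n <- rho g1) \sw_(h1 ⊗ h2 <- DeltaH h) \sw_(p ⊗ q <- rho h1)
    \sw_(p1 ⊗ p2 <- DeltaH p) \sw_(u ⊗ v <- DeltaH h2)
      F (act p1 b1) (mulH p2 m) (mulB q (act u (mulB b2 n))) (mulH v g2).
Proof.
move=> F1 F2 F3 F4 h b g.
have := hom_comulM bialgS (oneB ⊗ h) (b ⊗ g).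
rewrite mul_smash_comul smash_comul_smash_mul DeltaB1 => e0.
have e := congr1 (tlift (fun X Y => \sw_(x ⊗ y <- X) \sw_(z ⊗ w <- Y)
  F x y z w)) e0.
sw_nf_in e.
etransitivity; [|etransitivity; [exact: e|]].
- by do 5 apply: eq_sw => ? ?; rewrite !mul1B.
- by do 7 apply: eq_sw => ? ?; rewrite !mul1B.
Qed.

(** Take [g = 1] and apply [epsH] to both legs in [H]: the two legs in [B] remain. *)
Lemma smash_comul_act h b : DeltaB (act h b) =
  \sw_(h1 ⊗ h2 <- DeltaH h) \sw_(h10 ⊗ h11 <- rho h1)
  \sw_(b1 ⊗ b2 <- DeltaB b) act h10 b1 ⊗ mulB h11 (act h2 b2).
Proof.
have e : _ = _ := comulMF (F := fun x y z w => epsH y *: (epsH w *: (x ⊗ z)))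
  ltac:(lin) ltac:(lin) ltac:(lin) ltac:(lin) h b oneH.
(* With [g = 1] the right-hand side contains [rho oneH], whose value is already known. *)
rewrite DeltaH1 in e; sw_nf_in e; rewrite smash_coact1 in e; sw_nf_in e.
etransitivity; [|etransitivity; [exact: e|]].
- symmetry; sw_rw ltac:(rewrite !mulH1).
  sw_rw ltac:(refine (coact_counitl _ _); lin).
  sw_rw ltac:(refine (counitlH _ _); lin).
  sw_rw ltac:(refine (sw_scale _ _ _)).
  sw_rw ltac:(refine (counitrH _ _); lin).
  under eq_sw => ? ? do rewrite mulB1.
  by rewrite sw_tens.
- sw_rw ltac:(rewrite !mulH1 mulB1 scaleCA).
  sw_rw ltac:(refine (counitrH _ _); lin).
  sw_rw ltac:(refine (counitrH _ _); lin).
  sw_front (DeltaH h); apply: eq_sw => h1 h2.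
  by sw_front (rho h1).
Qed.

(** Again [g = 1], now with [epsB] on the first leg and [epsH] on the last; [smash_counit_act]
    evaluates [epsB] on the action in the first leg. *)
Lemma smash_coact_act h b :
  \sw_(h1 ⊗ h2 <- DeltaH h) \sw_(h20 ⊗ h21 <- rho h2)
    h20 ⊗ mulB (act h1 b) h21
  = \sw_(h1 ⊗ h2 <- DeltaH h) \sw_(h10 ⊗ h11 <- rho h1)
    h10 ⊗ mulB h11 (act h2 b).
Proof.
have e : _ = _ := comulMF (F := fun x y z w => epsB x *: (epsH w *: (y ⊗ z)))
  ltac:(lin) ltac:(lin) ltac:(lin) ltac:(lin) h b oneH.
rewrite DeltaH1 in e; sw_nf_in e; rewrite smash_coact1 in e; sw_nf_in e.
etransitivity; [|etransitivity; [exact: e|]].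
- symmetry; sw_rw ltac:(rewrite !mulH1).
  sw_rw ltac:(refine (exchange_sw _ (DeltaB _) (DeltaH _))).
  sw_rw ltac:(refine (exchange_sw _ (DeltaB _) (rho _))).
  sw_rw ltac:(refine (counitlB _ _); lin).
  sw_rw ltac:(refine (sw_scale _ _ _)).
  by sw_rw ltac:(refine (counitrH _ _); lin).
- sw_rw ltac:(rewrite !mulH1 mulB1 smash_counit_act scaleCA -scalerA).
  sw_rw ltac:(refine (counitrH _ _); lin).
  sw_rw ltac:(refine (counitlH _ _); lin).
  sw_front (DeltaH h); apply: eq_sw => h1 h2.
  sw_front (rho h1); apply: eq_sw => p q.
  by rewrite (counitlB (F := fun z => p ⊗ mulB q (act h2 z))) //; lin.
Qed.

(** The same two counits as for [smash_coact_act], at [b = 1] and general [g]. *)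
Lemma smash_coactM h g : rho (mulH h g) =
  \sw_(h1 ⊗ h2 <- DeltaH h) \sw_(h10 ⊗ h11 <- rho h1)
  \sw_(g0 ⊗ g1 <- rho g) mulH h10 g0 ⊗ mulB h11 (act h2 g1).
Proof.
have e : _ = _ := comulMF (F := fun x y z w => epsB x *: (epsH w *: (y ⊗ z)))
  ltac:(lin) ltac:(lin) ltac:(lin) ltac:(lin) h oneB g.
rewrite DeltaB1 in e; sw_nf_in e.
etransitivity; [|etransitivity; [exact: e|]].
- symmetry.
  sw_rw ltac:(refine (exchange_sw _ (DeltaB _) (DeltaH _))).
  sw_rw ltac:(refine (exchange_sw _ (DeltaB _) (DeltaH _))).
  sw_rw ltac:(refine (exchange_sw _ (DeltaB _) (rho _))).
  sw_rw ltac:(refine (counitlB _ _); lin).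
  sw_rw ltac:(rewrite act_one (bilinear_mapZl mB) mul1B
    (bilinear_mapZr (@tens_bilinear _ _ _)) scaleCA).
  do 3 sw_rw ltac:(refine (sw_scale _ _ _)).
  sw_rw ltac:(refine (counitlH _ _); lin).
  (* Read backwards, multiplicativity of [DeltaH] gathers the legs of [h] and [g] into the coproduct
     of [mulH h g], whose second leg the counit then removes. *)
  sw_rw ltac:(refine (esym (comulHM (F := fun s t => \sw_(u ⊗ v <- rho s)
    epsH t *: (u ⊗ v)) _ _ _)); lin).
  sw_rw ltac:(refine (sw_scale _ _ _)).
  sw_rw ltac:(refine (counitrH _ _); lin).
  by rewrite sw_tens.
- sw_rw ltac:(rewrite smash_counit_act epsB1 mulr1 mul1B epsHM scaleCA -scalerA).
  sw_rw ltac:(refine (counitrH _ _); lin).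
  sw_rw ltac:(rewrite scaleCA).
  sw_rw ltac:(refine (counitlH _ _); lin).
  sw_front (DeltaH h); apply: eq_sw => h1 h2.
  sw_front (rho h1); apply: eq_sw => p q.
  sw_rw ltac:(refine (sw_scale _ _ _)).
  by sw_rw ltac:(refine (counitrH _ _); lin).
Qed.

End Converse.

Theorem smash_bialgebraP :
  is_hom_bialgebra (id_aut (B ⊗ H)) smul (oneB ⊗ oneH) scom seps <->
  [/\ forall h b, DeltaB (act h b) =
        \sw_(h1 ⊗ h2 <- DeltaH h) \sw_(h10 ⊗ h11 <- rho h1)
        \sw_(b1 ⊗ b2 <- DeltaB b) act h10 b1 ⊗ mulB h11 (act h2 b2),
      forall h b, epsB (act h b) = epsH h * epsB b,
      rho oneH = oneH ⊗ oneB,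
      forall h b,
        \sw_(h1 ⊗ h2 <- DeltaH h) \sw_(h20 ⊗ h21 <- rho h2)
          h20 ⊗ mulB (act h1 b) h21
        = \sw_(h1 ⊗ h2 <- DeltaH h) \sw_(h10 ⊗ h11 <- rho h1)
          h10 ⊗ mulB h11 (act h2 b)
    & forall h g, rho (mulH h g) =
        \sw_(h1 ⊗ h2 <- DeltaH h) \sw_(h10 ⊗ h11 <- rho h1)
        \sw_(g0 ⊗ g1 <- rho g) mulH h10 g0 ⊗ mulB h11 (act h2 g1)].
Proof.
split=> [S | [c1 c2 c3 c4 c5]]; last exact: smash_bialgebra.
split; [exact: smash_comul_act | exact: smash_counit_act | exact: smash_coact1
  | exact: smash_coact_act | exact: smash_coactM].
Qed.

End Ordinary.

Definition inv_aut (k : fieldType) (V : lmodType k) (f : lin_aut V) : lin_aut V :=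
  LinAut (aut_inv_linear f) (aut_invK f) (aut_funK f).
Arguments inv_aut {k} {V%_type}.

(** * Twisting by automorphisms *)

Section Twist.
Variables (k : fieldType) (H : lmodType k) (alpha alpha' sigma : lin_aut H).
Variables (mul : H -> H -> H) (one : H) (Delta : H -> H ⊗ H) (eps : H -> k).
Hypothesis alphaE : forall x, alpha' x = sigma (alpha x).
Hypothesis sigmaC : forall x, sigma (alpha x) = alpha (sigma x).
Hypothesis sigmaM : forall x y, sigma (mul x y) = mul (sigma x) (sigma y).
Hypothesis sigma1 : sigma one = one.
Hypothesis sigma_comul : forall c,
  Delta (sigma c) = \sw_(c1 ⊗ c2 <- Delta c) sigma c1 ⊗ sigma c2.
Hypothesis sigma_counit : forall c, eps (sigma c) = eps c.
Hypothesis bialgH : is_hom_bialgebra alpha mul one Delta eps.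

Let mH := hom_mul_bilinear (hom_bialg_alg bialgH).
Let dH := hom_comul_linear (hom_bialg_coalg bialgH).
Let eH : linear (eps : H -> k^o) := hom_counit_linear (hom_bialg_coalg bialgH).

(** Both orders of the two inverses are recorded: coassociativity uses [sigma^-1] on the outside,
    the counit axioms use it on the inside. *)
Let alphaVE x : aut_inv alpha' x = aut_inv sigma (aut_inv alpha x).
Proof.
apply: (can_inj (aut_funK alpha')).
by rewrite aut_invK alphaE sigmaC aut_invK aut_invK.
Qed.

Let alphaVE' x : aut_inv alpha' x = aut_inv alpha (aut_inv sigma x).
Proof.
by apply: (can_inj (aut_funK alpha')); rewrite aut_invK alphaE !aut_invK.
Qed.

Let comul_inv (W : lmodType k) (F : H -> H -> W) c : bilinear_map F ->
  \sw_(x ⊗ y <- Delta (aut_inv sigma c)) F x y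
  = \sw_(x ⊗ y <- Delta c) F (aut_inv sigma x) (aut_inv sigma y).
Proof.
move=> hF; rewrite -[in RHS](aut_invK sigma c) sigma_comul.
symmetry; etransitivity; [sw_nf|].
by apply: eq_sw => x y; rewrite !aut_funK.
Qed.

(** Each axiom is the old one transported along [sigma], a bialgebra automorphism commuting with
    [alpha]. A general [sigma] lets one lemma serve both ways: [sigma = alpha^-1] untwists to the
    identity, and [alpha = id] twists an ordinary bialgebra by [sigma]. *)
Lemma hom_bialgebra_twist :
  is_hom_bialgebra alpha' (fun a b => sigma (mul a b)) one
    (fun c => Delta (aut_inv sigma c)) eps.
Proof.
have [bm mA m1 m1' aM a1] := hom_bialg_alg bialgH.
split.
- split.
  + lin.
  + by move=> a b c; rewrite !alphaE -!sigmaM mA.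
  + by move=> a; rewrite m1 alphaE.
  + by move=> a; rewrite m1' alphaE.
  + by move=> a b; rewrite !alphaE -!sigmaC aM -sigmaM.
  + by rewrite alphaE a1 sigma1.
- have cH := hom_bialg_coalg bialgH.
  split.
  + lin.
  + exact: eH.
  + move=> c.
    sw_rw ltac:(refine (comul_inv (F := fun x y => aut_inv alpha' _ ⊗ (x ⊗ y)) _ _);
      lin).
    sw_rw ltac:(rewrite alphaVE).
    (* Old coassociativity with [sigma^-1] on all three legs; on the outer leg it comes from the
       inverse of [alpha']. *)
    etransitivity; [refine (coassocF cH (F := fun x y z =>
      aut_inv sigma x ⊗ (aut_inv sigma y ⊗ aut_inv sigma z)) _ _ _ _); lin|].
    symmetry.
    sw_rw ltac:(refine (comul_inv (F := fun x y => x ⊗ (y ⊗ aut_inv alpha' _)) _ _);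
      lin).
    by sw_rw ltac:(rewrite alphaVE).
  + by move=> c; rewrite (hom_counitr cH) alphaVE'.
  + by move=> c; rewrite (hom_counitl cH) alphaVE'.
  + move=> c; rewrite alphaE aut_funK (hom_comul_aut cH).
    symmetry; etransitivity; [refine (comul_inv _ _); lin|].
    by apply: eq_sw => x y; rewrite !alphaE !sigmaC !aut_invK.
  + by move=> c; rewrite alphaE sigma_counit (hom_counit_aut cH).
- move=> g h; rewrite aut_funK (hom_comulM bialgH) /tens_mul.
  symmetry; etransitivity; [refine (comul_inv _ _); lin|].
  apply: eq_sw => x y; etransitivity; [refine (comul_inv _ _); lin|].
  by apply: eq_sw => z w; rewrite !sigmaM !aut_invK.
- by rewrite -[one in LHS]sigma1 aut_funK (hom_comul1 bialgH).
- by move=> g h; rewrite sigma_counit (hom_counitM bialgH).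
- exact: (hom_counit1 bialgH).
Qed.

End Twist.

Lemma inv_autK (k : fieldType) (V : lmodType k) (f : lin_aut V) (x : V) :
  id_aut V x = inv_aut f (f x).
Proof. by rewrite /= aut_funK. Qed.

Lemma inv_aut_comul (k : fieldType) (V : lmodType k) (f : lin_aut V)
    (D : V -> V ⊗ V) c :
  (forall c, D (f c) = \sw_(c1 ⊗ c2 <- D c) f c1 ⊗ f c2) ->
  D (inv_aut f c) = \sw_(c1 ⊗ c2 <- D c) inv_aut f c1 ⊗ inv_aut f c2.
Proof.
move=> hD; rewrite -{2}(aut_invK f c) hD.
symmetry; etransitivity; [sw_nf|].
by under eq_sw => ? ? do rewrite /= !aut_funK; rewrite sw_tens.
Qed.

Lemma untwist_bialgebra (k : fieldType) (V : lmodType k) (f : lin_aut V) mul one D eps :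
  is_hom_bialgebra f mul one D eps ->
  is_hom_bialgebra (id_aut V) (fun a b => aut_inv f (mul a b)) one
    (fun c => D (f c)) eps.
Proof.
move=> hV; have [_ _ _ _ fM f1] := hom_bialg_alg hV.
have [_ _ _ _ _ fD fe] := hom_bialg_coalg hV.
have := @hom_bialgebra_twist _ _ f (id_aut V) (inv_aut f); apply => //.
- exact: inv_autK.
- by move=> x; rewrite /= aut_funK aut_invK.
- by move=> x y; apply: (can_inj (aut_funK f)); rewrite fM /= !aut_invK.
- by rewrite -[in LHS]f1 /= aut_funK.
- by move=> c; apply: inv_aut_comul.
- by move=> c; rewrite -[in RHS](aut_invK f c) fe.
Qed.

(** * Untwisting the module algebra, the comodule coalgebra and the smash structures *)

Section Untwist.
Variables (k : fieldType) (B H : lmodType k) (beta : lin_aut B) (alpha : lin_aut H).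
Variables (mulB : B -> B -> B) (oneB : B) (DeltaB : B -> B ⊗ B) (epsB : B -> k).
Variables (mulH : H -> H -> H) (oneH : H) (DeltaH : H -> H ⊗ H) (epsH : H -> k).
Variables (act : H -> B -> B) (rho : H -> H ⊗ B).
Hypothesis bialgB : is_hom_bialgebra beta mulB oneB DeltaB epsB.
Hypothesis bialgH : is_hom_bialgebra alpha mulH oneH DeltaH epsH.
Hypothesis modB : is_hom_module_algebra alpha mulH oneH DeltaH epsH
  beta mulB oneB act.
Hypothesis comodH : is_hom_comodule_coalgebra beta mulB oneB DeltaB epsB
  alpha DeltaH epsH rho.

Let mB := hom_mul_bilinear (hom_bialg_alg bialgB).
Let mH := hom_mul_bilinear (hom_bialg_alg bialgH).
Let mA := hom_act_bilinear (hom_modalg_mod modB).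
Let dB := hom_comul_linear (hom_bialg_coalg bialgB).
Let dH := hom_comul_linear (hom_bialg_coalg bialgH).
Let dR := hom_coact_linear (hom_comodcoalg_comod comodH).
Let eB : linear (epsB : B -> k^o) := hom_counit_linear (hom_bialg_coalg bialgB).
Let eH : linear (epsH : H -> k^o) := hom_counit_linear (hom_bialg_coalg bialgH).

(** Primes mark the untwisted structures. *)
Let mulB' a b := aut_inv beta (mulB a b).
Let mulH' a b := aut_inv alpha (mulH a b).
Let DeltaB' b := DeltaB (beta b).
Let DeltaH' h := DeltaH (alpha h).
Let act' h b := aut_inv beta (act h b).
Let rho' h := rho (alpha h).

Let betaVM a b : aut_inv beta (mulB a b) = mulB (aut_inv beta a) (aut_inv beta b).
Proof.
apply: (can_inj (aut_funK beta)).
by rewrite (hom_autM (hom_bialg_alg bialgB)) !aut_invK.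
Qed.
Let alphaVM a b : aut_inv alpha (mulH a b) = mulH (aut_inv alpha a) (aut_inv alpha b).
Proof.
apply: (can_inj (aut_funK alpha)).
by rewrite (hom_autM (hom_bialg_alg bialgH)) !aut_invK.
Qed.
Let betaVA h b : aut_inv beta (act h b) = act (aut_inv alpha h) (aut_inv beta b).
Proof.
apply: (can_inj (aut_funK beta)).
by rewrite (hom_act_aut (hom_modalg_mod modB)) !aut_invK.
Qed.
Let betaV1 : aut_inv beta oneB = oneB.
Proof. by rewrite -[oneB in LHS](hom_aut1 (hom_bialg_alg bialgB)) aut_funK. Qed.

Section Multilinear.
Variable W : lmodType k.

Lemma comulB_aut (F : B -> B -> W) c : bilinear_map F ->
  \sw_(x ⊗ y <- DeltaB (beta c)) F x y
  = \sw_(x ⊗ y <- DeltaB c) F (beta x) (beta y).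
Proof. by move=> hF; rewrite (hom_comul_aut (hom_bialg_coalg bialgB)); sw_nf. Qed.

Lemma comulH_aut (F : H -> H -> W) c : bilinear_map F ->
  \sw_(x ⊗ y <- DeltaH (alpha c)) F x y
  = \sw_(x ⊗ y <- DeltaH c) F (alpha x) (alpha y).
Proof. by move=> hF; rewrite (hom_comul_aut (hom_bialg_coalg bialgH)); sw_nf. Qed.

Lemma coact_aut (F : H -> B -> W) c : bilinear_map F ->
  \sw_(x ⊗ y <- rho (alpha c)) F x y
  = \sw_(x ⊗ y <- rho c) F (alpha x) (beta y).
Proof. by move=> hF; rewrite (hom_coact_aut (hom_comodcoalg_comod comodH)); sw_nf. Qed.

End Multilinear.

Lemma untwist_module_algebra :
  is_hom_module_algebra (id_aut H) mulH' oneH DeltaH' epsH (id_aut B) mulB' oneB act'.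
Proof.
have [_ aA a1 aa] := hom_modalg_mod modB.
split.
- exact: (hom_bialg_alg (untwist_bialgebra bialgB)).
- split.
  + rewrite /act'; lin.
  + move=> h g b; rewrite /act' /mulH' /=; congr (aut_inv beta _).
    by apply: (can_inj (aut_funK beta)); rewrite !aa !aut_invK aA.
  + by move=> b; rewrite /act' a1 /= aut_funK.
  + by [].
- move=> h a b; rewrite /act' /mulB' /DeltaH'.
  symmetry; etransitivity; [refine (comulH_aut _ _); lin|].
  rewrite betaVM (hom_actM modB) (linear_sw (f := aut_inv beta)); last by lin.
  by apply: eq_sw => x y; congr (aut_inv beta (mulB _ _)); rewrite betaVA aut_funK.
- move=> h; rewrite /act' (hom_act_one modB) -[in RHS]betaV1.
  have := aut_inv_linear beta (epsH h) oneB 0.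
  by rewrite !addr0 (linear_map0 (aut_inv_linear beta)) addr0.
Qed.

Lemma untwist_comodule_coalgebra :
  is_hom_comodule_coalgebra (id_aut B) mulB' oneB DeltaB' epsB
    (id_aut H) DeltaH' epsH rho'.
Proof.
have cH := hom_comodcoalg_comod comodH.
split.
- exact: (hom_bialg_coalg (untwist_bialgebra bialgH)).
- split; rewrite /rho' /DeltaB'.
  + lin.
  + move=> m /=.
    sw_rw ltac:(refine (comulB_aut _ _); lin).
    (* The Hom-axiom at [alpha m] is composed with [alpha ⊗ beta ⊗ beta], which cancels the inverse
       automorphisms on its outer legs. *)
    have e := congr1 (tlift (fun x t => \sw_(y ⊗ z <- t)
      alpha x ⊗ (beta y ⊗ beta z))) (hom_coactA cH (alpha m)).
    sw_nf_in e.
    etransitivity; [|etransitivity; [exact: e|]].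
    * by do 2 apply: eq_sw => ? ?; rewrite aut_invK.
    * symmetry; etransitivity; [apply: eq_sw => ? ?; refine (coact_aut _ _); lin|].
      by do 2 apply: eq_sw => ? ?; rewrite aut_invK.
  + by move=> m; rewrite (hom_coact_counit cH) aut_funK.
  + by move=> m /=; rewrite sw_tens.
- move=> c; rewrite /rho' /DeltaH' /mulB'.
  sw_rw ltac:(refine (comulH_aut _ _); lin).
  have e := congr1 (tlift (fun x t => \sw_(y ⊗ z <- t)
      alpha x ⊗ (alpha y ⊗ z))) (hom_coact_comul comodH (alpha c)).
  sw_nf_in e; rewrite e.
  symmetry; apply: eq_sw => x y.
  etransitivity; [refine (coact_aut _ _); lin|].
  apply: eq_sw => ? ?.
  etransitivity; [refine (coact_aut _ _); lin|].
  by apply: eq_sw => ? ?; rewrite betaVM !aut_funK.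
- move=> c; rewrite /rho' (hom_coact_eps comodH).
  by rewrite (hom_counit_aut (hom_bialg_coalg bialgH)).
Qed.

Let smul := smash_mul beta alpha mulB mulH DeltaH act.
Let scom := smash_comul beta alpha mulB DeltaB DeltaH rho.
Let smul' := smash_mul (id_aut B) (id_aut H) mulB' mulH' DeltaH' act'.
Let scom' := smash_comul (id_aut B) (id_aut H) mulB' DeltaB' DeltaH' rho'.
Let tau := tens_aut beta alpha.

Let tauE a h : tau (a ⊗ h) = beta a ⊗ alpha h.
Proof. by apply: tmap_tens; lin. Qed.
Let tauVE a h : aut_inv tau (a ⊗ h) = aut_inv beta a ⊗ aut_inv alpha h.
Proof. by apply: tmap_tens; lin. Qed.

Let mS : bilinear_map smul.
Proof. by rewrite /smul /smash_mul; lin. Qed.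
Let dS : linear scom.
Proof. by rewrite /scom /smash_comul; lin. Qed.

Let smulE a h b g : smul (a ⊗ h) (b ⊗ g) = \sw_(h1 ⊗ h2 <- DeltaH h)
  mulB a (act h1 (aut_inv beta b)) ⊗ mulH (alpha h2) g.
Proof. by rewrite /smul /smash_mul; sw_nf. Qed.

Let scomE a h : scom (a ⊗ h) =
  \sw_(a1 ⊗ a2 <- DeltaB a) \sw_(h1 ⊗ h2 <- DeltaH h)
  \sw_(h10 ⊗ h11 <- rho h1)
    (a1 ⊗ alpha h10) ⊗ (mulB (aut_inv beta a2) h11 ⊗ h2).
Proof. by rewrite /scom /smash_comul; sw_nf. Qed.

Let smul'E a h b g : smul' (a ⊗ h) (b ⊗ g) = \sw_(h1 ⊗ h2 <- DeltaH (alpha h))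
  aut_inv beta (mulB a (aut_inv beta (act h1 b))) ⊗ aut_inv alpha (mulH h2 g).
Proof. by rewrite /smul' /smash_mul /mulB' /mulH' /DeltaH' /act' /=; sw_nf. Qed.

Let scom'E a h : scom' (a ⊗ h) =
  \sw_(a1 ⊗ a2 <- DeltaB (beta a)) \sw_(h1 ⊗ h2 <- DeltaH (alpha h))
  \sw_(h10 ⊗ h11 <- rho (alpha h1))
    (a1 ⊗ h10) ⊗ (aut_inv beta (mulB a2 h11) ⊗ h2).
Proof.
by rewrite /scom' /smash_comul /mulB' /DeltaB' /DeltaH' /rho' /=; sw_nf.
Qed.

(** With [untwist_smash_comul]: forming smash structures commutes with untwisting, since the
    operations involved all commute with [alpha] and [beta]. *)
Lemma untwist_smash_mul x y : smul' x y = aut_inv tau (smul x y).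
Proof.
have mS' : bilinear_map smul'.
  by rewrite /smul' /smash_mul /mulB' /mulH' /DeltaH' /act' /=; lin.
tens_elim x => a h; tens_elim y => b g.
rewrite smulE smul'E (linear_sw (f := aut_inv tau)); last exact: aut_inv_linear.
transitivity (\sw_(h1 ⊗ h2 <- DeltaH h)
  aut_inv beta (mulB a (act h1 (aut_inv beta b)))
  ⊗ aut_inv alpha (mulH (alpha h2) g)); last first.
  by apply: eq_sw => h1 h2; rewrite tauVE.
etransitivity; [refine (comulH_aut _ _); lin|].
by apply: eq_sw => h1 h2; rewrite [aut_inv beta (act (alpha _) _)]betaVA aut_funK.
Qed.

Lemma untwist_smash_comul x : scom' x = scom (tau x).
Proof.
have dS' : linear scom'.
  by rewrite /scom' /smash_comul /mulB' /DeltaB' /DeltaH' /rho' /=; lin.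
tens_elim x => a h.
rewrite tauE scomE scom'E.
do 2 apply: eq_sw => ? ?.
etransitivity; [refine (coact_aut _ _); lin|].
by apply: eq_sw => ? ?; rewrite betaVM aut_funK.
Qed.

(** This and the next two lemmas make [tau] an automorphism of the smash structure, as required for
    twisting by it in [untwist_smash_bialgebra]. *)
Lemma smash_mul_aut x y : tau (smul x y) = smul (tau x) (tau y).
Proof.
tens_elim x => a h; tens_elim y => b g.
rewrite !tauE !smulE (linear_sw (f := tau)); last exact: aut_linear.
symmetry; etransitivity; [refine (comulH_aut _ _); lin|].
apply: eq_sw => ? ?; rewrite tauE (hom_autM (hom_bialg_alg bialgH)).
rewrite (hom_autM (hom_bialg_alg bialgB)) (hom_act_aut (hom_modalg_mod modB)).
by rewrite aut_funK aut_invK.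
Qed.

Lemma smash_comul_aut x :
  scom (tau x) = \sw_(c1 ⊗ c2 <- scom x) tau c1 ⊗ tau c2.
Proof.
tens_elim x => a h.
rewrite tauE !scomE.
etransitivity; [refine (comulB_aut _ _); lin|].
symmetry; etransitivity; [sw_nf|]; apply: eq_sw => ? ?.
symmetry; etransitivity; [refine (comulH_aut _ _); lin|]; apply: eq_sw => ? ?.
etransitivity; [refine (coact_aut _ _); lin|]; apply: eq_sw => ? ?.
by rewrite !tauE (hom_autM (hom_bialg_alg bialgB)) aut_funK aut_invK.
Qed.

Lemma smash_counit_aut x : smash_counit epsB epsH (tau x) = smash_counit epsB epsH x.
Proof.
have eS : linear (smash_counit epsB epsH : B ⊗ H -> k^o).
  by rewrite /smash_counit; lin.
have eS' : linear (fun x => smash_counit epsB epsH (tau x) : k^o) by lin.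
have seE a h : smash_counit epsB epsH (a ⊗ h) = epsB a * epsH h.
  by rewrite /smash_counit; sw_nf.
apply: (tens_ext eS' eS) => a h; rewrite tauE !seE.
by rewrite (hom_counit_aut (hom_bialg_coalg bialgB))
  (hom_counit_aut (hom_bialg_coalg bialgH)).
Qed.

Lemma untwist_smash_bialgebra :
  is_hom_bialgebra tau smul (oneB ⊗ oneH) scom (smash_counit epsB epsH) <->
  is_hom_bialgebra (id_aut (B ⊗ H)) smul' (oneB ⊗ oneH) scom'
    (smash_counit epsB epsH).
Proof.
have -> : smul' = fun x y => aut_inv tau (smul x y).
  by apply/funext => x; apply/funext => y; apply: untwist_smash_mul.
have -> : scom' = fun x => scom (tau x).
  by apply/funext => x; apply: untwist_smash_comul.
split=> [S|S]; first exact: untwist_bialgebra.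
(* The way back twists the ordinary smash bialgebra by [sigma = tau]. *)
have := @hom_bialgebra_twist _ _ (id_aut (B ⊗ H)) tau tau _ _ _ _ _ _ _ _ _ _ S.
have -> : (fun a b => tau (aut_inv tau (smul a b))) = smul.
  by apply/funext => x; apply/funext => y; rewrite aut_invK.
have -> : (fun c => scom (tau (aut_inv tau c))) = scom.
  by apply/funext => x; rewrite aut_invK.
apply => //.
- by move=> x y; rewrite -[in RHS]smash_mul_aut aut_invK aut_funK.
- by rewrite tauE (hom_aut1 (hom_bialg_alg bialgB)) (hom_aut1 (hom_bialg_alg bialgH)).
- by move=> c; apply: smash_comul_aut.
- exact: smash_counit_aut.
Qed.

(** * Translation of the five conditions between the twisted and untwisted forms *)

Let actVE h b : aut_inv beta (act (alpha h) (beta b)) = act h b.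
Proof. by rewrite betaVA !aut_funK. Qed.

Lemma untwist_comul_act h b :
  \sw_(h1 ⊗ h2 <- DeltaH' h) \sw_(h10 ⊗ h11 <- rho' h1)
  \sw_(b1 ⊗ b2 <- DeltaB' b) act' h10 b1 ⊗ mulB' h11 (act' h2 b2)
  = \sw_(h1 ⊗ h2 <- DeltaH h) \sw_(h10 ⊗ h11 <- rho h1)
    \sw_(b1 ⊗ b2 <- DeltaB b)
      act (alpha h10) b1
      ⊗ mulB (beta h11) (act (aut_inv alpha h2) (aut_inv beta b2)).
Proof.
rewrite /DeltaH' /rho' /DeltaB' /act' /mulB'.
etransitivity; [refine (comulH_aut _ _); lin|]; apply: eq_sw => h1 h2.
etransitivity; [refine (coact_aut _ _); lin|].
etransitivity; [refine (coact_aut _ _); lin|]; apply: eq_sw => p q.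
etransitivity; [refine (comulB_aut _ _); lin|]; apply: eq_sw => b1 b2.
by rewrite betaVM aut_funK !actVE betaVA.
Qed.

Lemma untwist_coactM h g :
  \sw_(h1 ⊗ h2 <- DeltaH' h) \sw_(h10 ⊗ h11 <- rho' h1)
  \sw_(g0 ⊗ g1 <- rho' g) mulH' h10 g0 ⊗ mulB' h11 (act' h2 g1)
  = \sw_(h1 ⊗ h2 <- DeltaH h) \sw_(h10 ⊗ h11 <- rho h1)
    \sw_(g0 ⊗ g1 <- rho g)
      mulH (alpha h10) g0
      ⊗ mulB (beta h11) (act (aut_inv alpha h2) (aut_inv beta g1)).
Proof.
rewrite /DeltaH' /rho' /act' /mulB' /mulH'.
etransitivity; [refine (comulH_aut _ _); lin|]; apply: eq_sw => h1 h2.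
etransitivity; [refine (coact_aut _ _); lin|].
etransitivity; [refine (coact_aut _ _); lin|]; apply: eq_sw => p q.
etransitivity; [refine (coact_aut _ _); lin|]; apply: eq_sw => m n.
by rewrite alphaVM !aut_funK betaVM aut_funK actVE betaVA.
Qed.

(** Each side of the fourth condition untwists to its Hom-form at [beta^-1 b] followed by
    [alpha^2 ⊗ beta^-1]. This map is injective, so it can be cancelled. *)
Let zeta : H ⊗ B -> H ⊗ B :=
  tmap (fun h => alpha (alpha h)) (aut_inv beta).
Let zetaE h b : zeta (h ⊗ b) = alpha (alpha h) ⊗ aut_inv beta b.
Proof. by apply: tmap_tens; lin. Qed.
Let zeta_linear : linear zeta.
Proof. by apply: tmap_linear; lin. Qed.
Let zeta_inj : injective zeta.
Proof.
pose xi := tmap (fun h => aut_inv alpha (aut_inv alpha h)) beta.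
have lxi : linear xi by apply: tmap_linear; lin.
have xiE h b : xi (h ⊗ b) = aut_inv alpha (aut_inv alpha h) ⊗ beta b.
  by apply: tmap_tens; lin.
apply: (can_inj (g := xi)) => x; tens_elim x => h b.
by rewrite zetaE xiE !aut_funK aut_invK.
Qed.

Lemma untwist_coact_act_l h b :
  \sw_(h1 ⊗ h2 <- DeltaH' h) \sw_(h20 ⊗ h21 <- rho' h2)
    h20 ⊗ mulB' (act' h1 b) h21
  = zeta (\sw_(h1 ⊗ h2 <- DeltaH h) \sw_(h20 ⊗ h21 <- rho h2)
      h20 ⊗ mulB (act h1 (aut_inv beta b)) (beta (beta h21))).
Proof.
rewrite /DeltaH' /rho' /act' /mulB' linear_sw //.
etransitivity; [refine (comulH_aut _ _); lin|]; apply: eq_sw => h1 h2.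
rewrite linear_sw //.
etransitivity; [refine (coact_aut _ _); lin|].
etransitivity; [refine (coact_aut _ _); lin|]; apply: eq_sw => p q.
by rewrite zetaE [aut_inv beta (act (alpha _) _)]betaVA aut_funK.
Qed.

Lemma untwist_coact_act_r h b :
  \sw_(h1 ⊗ h2 <- DeltaH' h) \sw_(h10 ⊗ h11 <- rho' h1)
    h10 ⊗ mulB' h11 (act' h2 b)
  = zeta (\sw_(h1 ⊗ h2 <- DeltaH h) \sw_(h10 ⊗ h11 <- rho h1)
      h10 ⊗ mulB (beta (beta h11)) (act h2 (aut_inv beta b))).
Proof.
rewrite /DeltaH' /rho' /act' /mulB' linear_sw //.
etransitivity; [refine (comulH_aut _ _); lin|]; apply: eq_sw => h1 h2.
rewrite linear_sw //.
etransitivity; [refine (coact_aut _ _); lin|].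
etransitivity; [refine (coact_aut _ _); lin|]; apply: eq_sw => p q.
by rewrite zetaE [aut_inv beta (act (alpha _) _)]betaVA aut_funK.
Qed.

Theorem smash_hom_bialgebraP :
  is_hom_bialgebra tau smul (oneB ⊗ oneH) scom (smash_counit epsB epsH) <->
  [/\ forall h b, DeltaB (act h b)
        = \sw_(h1 ⊗ h2 <- DeltaH h) \sw_(h10 ⊗ h11 <- rho h1)
          \sw_(b1 ⊗ b2 <- DeltaB b)
            act (alpha h10) b1
            ⊗ mulB (beta h11) (act (aut_inv alpha h2) (aut_inv beta b2)),
      forall h b, epsB (act h b) = epsH h * epsB b,
      rho oneH = oneH ⊗ oneB,
      forall h b,
        \sw_(h1 ⊗ h2 <- DeltaH h) \sw_(h20 ⊗ h21 <- rho h2)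
          h20 ⊗ mulB (act h1 b) (beta (beta h21))
        = \sw_(h1 ⊗ h2 <- DeltaH h) \sw_(h10 ⊗ h11 <- rho h1)
          h10 ⊗ mulB (beta (beta h11)) (act h2 b)
    & forall h g, rho (mulH h g)
        = \sw_(h1 ⊗ h2 <- DeltaH h) \sw_(h10 ⊗ h11 <- rho h1)
          \sw_(g0 ⊗ g1 <- rho g)
            mulH (alpha h10) g0
            ⊗ mulB (beta h11) (act (aut_inv alpha h2) (aut_inv beta g1))].
Proof.
have epsV b : epsB (aut_inv beta b) = epsB b.
  by rewrite -[in RHS](aut_invK beta b) (hom_counit_aut (hom_bialg_coalg bialgB)).
have a1 := hom_aut1 (hom_bialg_alg bialgH).
rewrite untwist_smash_bialgebra smash_bialgebraP //; last first.
- exact: untwist_comodule_coalgebra.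
- exact: untwist_module_algebra.
- exact: untwist_bialgebra.
- exact: untwist_bialgebra.
split=> [] [c1 c2 c3 c4 c5]; split.
(* The twists cancel in the term on the left: [DeltaB' (act' h b)] is [DeltaB (act h b)]. The fifth
   condition works likewise with [rho'] and [mulH']. *)
- by move=> h b; rewrite -untwist_comul_act -c1 /DeltaB' /act' aut_invK.
- by move=> h b; rewrite -c2 /act' epsV.
- by rewrite -c3 /rho' a1.
(* The untwisted condition is taken at [beta b] to offset the [beta^-1] introduced by untwisting. *)
- move=> h b; apply: zeta_inj; have := c4 h (beta b).
  by rewrite untwist_coact_act_l untwist_coact_act_r aut_funK.
- by move=> h g; rewrite -untwist_coactM -c5 /rho' /mulH' aut_invK.
- by move=> h b; rewrite untwist_comul_act -c1 /DeltaB' /act' aut_invK.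
- by move=> h b; rewrite -c2 /act' epsV.
- by rewrite -c3 /rho' a1.
- by move=> h b; rewrite untwist_coact_act_l untwist_coact_act_r c4.
- by move=> h g; rewrite untwist_coactM -c5 /rho' /mulH' aut_invK.
Qed.

End Untwist.

Theorem theorem2p2 (k : fieldType) (B H : lmodType k)
  (beta : lin_aut B) (mulB : B -> B -> B) (oneB : B)
  (DeltaB : B -> B ⊗ B) (epsB : B -> k) (SB : B -> B)
  (alpha : lin_aut H) (mulH : H -> H -> H) (oneH : H)
  (DeltaH : H -> H ⊗ H) (epsH : H -> k) (SH : H -> H)
  (act : H -> B -> B) (rho : H -> H ⊗ B)
  (hopfB : is_hom_hopf beta mulB oneB DeltaB epsB SB)
  (hopfH : is_hom_hopf alpha mulH oneH DeltaH epsH SH)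
  (modB : is_hom_module_algebra alpha mulH oneH DeltaH epsH
            beta mulB oneB act)
  (comodH : is_hom_comodule_coalgebra beta mulB oneB DeltaB epsB
              alpha DeltaH epsH rho) :
  is_hom_bialgebra (tens_aut beta alpha)
    (smash_mul beta alpha mulB mulH DeltaH act)
    (oneB ⊗ oneH)
    (smash_comul beta alpha mulB DeltaB DeltaH rho)
    (smash_counit epsB epsH)
  <->
  [/\ forall (h : H) (b : B),
        DeltaB (act h b)
        = \sw_(h1 ⊗ h2 <- DeltaH h) \sw_(h10 ⊗ h11 <- rho h1)
          \sw_(b1 ⊗ b2 <- DeltaB b)
            act (alpha h10) b1
            ⊗ mulB (beta h11) (act (aut_inv alpha h2) (aut_inv beta b2)),
      forall (h : H) (b : B), epsB (act h b) = epsH h * epsB b,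
      rho oneH = oneH ⊗ oneB,
      forall (h : H) (b : B),
        \sw_(h1 ⊗ h2 <- DeltaH h) \sw_(h20 ⊗ h21 <- rho h2)
          h20 ⊗ mulB (act h1 b) (beta (beta h21))
        = \sw_(h1 ⊗ h2 <- DeltaH h) \sw_(h10 ⊗ h11 <- rho h1)
          h10 ⊗ mulB (beta (beta h11)) (act h2 b)
    & forall (h g : H),
        rho (mulH h g)
        = \sw_(h1 ⊗ h2 <- DeltaH h) \sw_(h10 ⊗ h11 <- rho h1)
          \sw_(g0 ⊗ g1 <- rho g)
            mulH (alpha h10) g0
            ⊗ mulB (beta h11) (act (aut_inv alpha h2) (aut_inv beta g1))].
Proof.
exact: (smash_hom_bialgebraP (hom_hopf_bialg hopfB) (hom_hopf_bialg hopfH)).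
Qed.
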